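(* $e^+$-\textsc{Connected Vertex Cover} does not have a polynomial kernel unless $\mathrm{NP}\subseteq\mathrm{coNP}/\mathrm{poly}$.
   Context: A connected vertex cover of a graph $G=(V,E)$ is a set $A\subseteq V$ such that every edge has an endpoint in $A$ and the subgraph induced by $A$ is connected. \textsc{Connected Vertex Cover}: given $G$ and $k$, decide whether $G$ has a connected vertex cover of size at most $k$ (a minimization problem, parameter $k$). The local modification $G+e$ adds an edge between two non-adjacent vertices. Instances of $e^+$-\textsc{Connected Vertex Cover} are $((G,k),s,(G+e,k'))$ with $s$ a connected vertex cover of $G$ of size at most $k$ if one exists and $s=\bot$ otherwise, and $k'\le k$; yes-instances are those where $G+e$ has a connected vertex cover of size at most $k'$. A polynomial kernel for such an instance is an instance of \textsc{Connected Vertex Cover} computed in polynomial time, equivalent to $(G+e,k')$, whose size and parameter are polynomial in the parameter. *)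

(* Defs.v *)
From mathcomp Require Import all_boot.

Set Implicit Arguments.
Unset Strict Implicit.
Unset Printing Implicit Defensive.

Definition poly_bound (c n : nat) : nat := n ^ c + c.

(* Deterministic multi-tape Turing machines. A cell is blank ([None]), a bit
   ([Some (inl b)]) or a further work symbol. A tape is two-way infinite: in
   [(l, r)], [l] is the part left of the head, nearest cell first, and [r] is
   the rest, starting with the scanned cell; everything beyond is blank.
   Tape [ord0] initially holds the input and finally holds the output. *)

Inductive move := Left | Stay | Right.

Definition cell (S : finType) : finType := option (bool + S)%type.

Definition tape (S : finType) : Type := (seq (cell S) * seq (cell S))%type.

Record TM := MkTM {
  tm_work : nat;
  tm_sym : finType;
  tm_state : finType;
  tm_start : tm_state;
  tm_halt : pred tm_state;
  tm_trans : tm_state -> {ffun 'I_tm_work.+1 -> cell tm_sym} ->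
             tm_state * {ffun 'I_tm_work.+1 -> cell tm_sym * move} }.

Definition scanned (S : finType) (t : tape S) : cell S := head None t.2.

Definition act (S : finType) (t : tape S) (am : cell S * move) : tape S :=
  match am.2 with
  | Left => (behead t.1, head None t.1 :: am.1 :: behead t.2)
  | Stay => (t.1, am.1 :: behead t.2)
  | Right => (am.1 :: t.1, behead t.2)
  end.

Definition config (M : TM) : Type :=
  (tm_state M * {ffun 'I_(tm_work M).+1 -> tape (tm_sym M)})%type.

Definition init (M : TM) (x : seq bool) : config M :=
  (tm_start M,
   [ffun i => ([::], if i == ord0 then [seq Some (inl b) | b <- x] else [::])]).

(* Halting configurations are fixed points of [step]. *)
Definition step (M : TM) (c : config M) : config M :=
  if tm_halt c.1 then c else
  let d := tm_trans c.1 [ffun i => scanned (c.2 i)] in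
  (d.1, [ffun i => act (c.2 i) (d.2 i)]).

Fixpoint leading_bits (S : finType) (r : seq (cell S)) : seq bool :=
  if r is Some (inl b) :: r' then b :: leading_bits r' else [::].

Definition output (M : TM) (c : config M) : seq bool :=
  leading_bits (c.2 ord0).2.

Definition computes_within (M : TM) (x : seq bool) (t : nat) (y : seq bool) :
    Prop :=
  let c := iter t (@step M) (init M x) in tm_halt c.1 /\ output c = y.

Definition polytime (f : seq bool -> seq bool) : Prop :=
  exists (M : TM) (c : nat),
    forall x, computes_within M x (poly_bound c (size x)) (f x).

Definition language := seq bool -> Prop.

Definition in_P (L : language) : Prop :=
  exists f, polytime f /\ forall x, L x <-> f x = [:: true].

(* Each bit of [x] is preceded by [true]; the first [false] marker starts [y]. *)
Definition pair_code (x y : seq bool) : seq bool :=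
  flatten [seq [:: true; b] | b <- x] ++ false :: y.

Definition in_NP (L : language) : Prop :=
  exists (V : language) (c : nat), in_P V /\
    forall x, L x <->
      exists w, size w <= poly_bound c (size x) /\ V (pair_code x w).

Definition in_coNP (L : language) : Prop := in_NP (fun x => ~ L x).

Definition with_poly_advice (C : language -> Prop) (L : language) : Prop :=
  exists (L' : language) (a : nat -> seq bool) (c : nat),
    [/\ C L', forall n, size (a n) <= poly_bound c n
      & forall x, L x <-> L' (pair_code x (a (size x)))].

Definition NP_subset_coNP_poly : Prop :=
  forall L, in_NP L -> with_poly_advice in_coNP L.

Record sgraph (T : finType) := SGraph {
  adj :> rel T;
  adj_sym : symmetric adj;
  adj_irr : irreflexive adj }.

Definition vertex_cover (T : finType) (G : sgraph T) (A : {set T}) : Prop :=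
  forall x y, G x y -> (x \in A) || (y \in A).

(* The subgraph induced by [A] is connected; the empty one counts as such. *)
Definition induced_connected (T : finType) (G : sgraph T) (A : {set T}) : Prop :=
  forall x y, x \in A -> y \in A -> connect [rel u v in A | G u v] x y.

Definition connected_vertex_cover (T : finType) (G : sgraph T) (A : {set T}) :
    Prop :=
  vertex_cover G A /\ induced_connected G A.

Definition CVC (T : finType) (G : sgraph T) (k : nat) : Prop :=
  exists A : {set T}, connected_vertex_cover G A /\ #|A| <= k.

Definition is_edge_addition (T : finType) (G H : sgraph T) : Prop :=
  exists u v : T, [/\ u != v, ~~ G u v
    & forall x y, H x y = [|| G x y, (x, y) == (u, v) | (x, y) == (v, u)]].

(* [ri_sol = None] stands for the symbol "bottom". *)
Record reopt_data := ReoptData {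
  ri_order : nat;
  ri_old : sgraph 'I_ri_order;
  ri_k : nat;
  ri_sol : option {set 'I_ri_order};
  ri_new : sgraph 'I_ri_order;
  ri_k' : nat }.

Definition ePlus_CVC_instance (I : reopt_data) : Prop :=
  [/\ is_edge_addition (ri_old I) (ri_new I),
      match ri_sol I with
      | Some A => connected_vertex_cover (ri_old I) A /\ #|A| <= ri_k I
      | None => ~ CVC (ri_old I) (ri_k I)
      end
    & ri_k' I <= ri_k I].

(* Prefix-free encodings. Parameters are written in unary, so that the length of
   the code of an instance [(x, k)] is, up to a constant, [|x| + k]. *)
Definition enc_nat (k : nat) : seq bool := rcons (nseq k true) false.

(* The number of vertices, then the adjacency matrix, row by row. *)
Definition enc_graph (n : nat) (G : sgraph 'I_n) : seq bool :=
  enc_nat n ++ [seq G x y | x <- enum 'I_n, y <- enum 'I_n].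

Definition enc_sol (n : nat) (s : option {set 'I_n}) : seq bool :=
  if s is Some A then true :: [seq x \in A | x <- enum 'I_n] else [:: false].

Definition enc_CVC (n : nat) (G : sgraph 'I_n) (k : nat) : seq bool :=
  enc_graph G ++ enc_nat k.

Definition enc_reopt (I : reopt_data) : seq bool :=
  enc_CVC (ri_old I) (ri_k I) ++ enc_sol (ri_sol I)
  ++ enc_CVC (ri_new I) (ri_k' I).

(* A polynomial kernelization with respect to [param]. Validity of the given
   solution is a promise: nothing is required of the machine on other inputs. *)
Definition has_polynomial_kernel (param : reopt_data -> nat) : Prop :=
  exists (M : TM) (c : nat), forall I : reopt_data, ePlus_CVC_instance I ->
    exists (n : nat) (J : sgraph 'I_n) (l : nat),
      [/\ computes_within M (enc_reopt I) (poly_bound c (size (enc_reopt I)))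
            (enc_CVC J l),
          CVC J l <-> CVC (ri_new I) (ri_k' I),
          size (enc_CVC J l) <= poly_bound c (param I)
        & l <= poly_bound c (param I)].

(* Main.v *)
Require Import Defs.
From mathcomp Require Import all_boot.
From mathcomp Require Import zify.
From HB Require Import structures.
From Stdlib Require Import Classical ClassicalEpsilon.

Set Implicit Arguments.
Unset Strict Implicit.
Unset Printing Implicit Defensive.

(* For L in NP and a length n, the accepting runs of a verifier on inputs of
   length n form a multi-valued CNF of size poly(n). Letting one more node select
   the input among Y_0, ..., Y_t adds values for that node but no clauses, so the
   number of nodes and clauses does not grow with t. Read as a set cover instance
   (a set for each value of each node), the formula becomes a graph whose
   connected vertex covers of size k' = poly(n) witness that some Y_i is in L;
   the set cover elements lie in the cover, the sets form a huge independent
   set. Deleting an edge between two twin hubs and allowing one dummy set per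
   clause gives an old graph with an explicit solution of size k = poly(n).

   A kernel is then an OR-distillation of L, and the argument of Fortnow and
   Santhanam puts the complement of L in NP/poly. Advice makes this
   non-uniform, so no reduction has to be programmed: the advice is a CNF saying
   "there are Y and i with Y_i = x on which the kernelization ends with one of
   these few outputs", again a tableau, and the only machine that is written
   down evaluates CNFs. *)

(** * Polynomial bounds *)

(** The base [n + 2] is at least 2, so powers grow with the exponent even at [n = 0]. This makes the
    class visibly closed under sums, products and composition. *)
Definition pbounded (f : nat -> nat) : Prop :=
  exists c, forall n, f n <= (n + 2) ^ c.

Lemma leq_pow2 n c d : c <= d -> (n + 2) ^ c <= (n + 2) ^ d.
Proof. by move=> le_cd; rewrite leq_pexp2l // addn2. Qed.

Lemma leq_poly_bound c : {homo poly_bound c : m n / m <= n}.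
Proof.
by move=> m n le_mn; rewrite /poly_bound leq_add2r; case: c => // c; rewrite
    leq_exp2r.
Qed.

Lemma poly_bound_pow c n : poly_bound c n <= (n + 2) ^ c.+1.
Proof.
have le1: n ^ c <= (n + 2) ^ c.
  by case: c => // c; rewrite leq_exp2r // leq_addr.
have le2: c <= (n + 2) ^ c.
  by apply: (leq_trans (ltnW (ltn_expl c (isT : 1 < 2)))); case: c {le1} => // c;
      rewrite leq_exp2r // leq_addl.
by rewrite /poly_bound expnS mulnDl; nia.
Qed.

(** For [n >= 2], [n + 2 <= n * n] gives the bound [n ^ (2 * c)] with [2 * c <= 3 ^ c]. For [n <= 1]
    the additive constant [3 ^ c] suffices. *)
Lemma pow_poly_bound c n : (n + 2) ^ c <= poly_bound (3 ^ c) n.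
Proof.
have c3: 2 * c <= 3 ^ c by elim: c => // -[|c] //; rewrite !expnS; lia.
case: (leqP 2 n) => [n2 | n1]; last first.
  apply: leq_trans (leq_addl _ _); case: c {c3} => // c.
  by rewrite leq_exp2r //; lia.
apply: leq_trans (leq_addr _ _).
apply: (@leq_trans (n ^ (2 * c))); last by rewrite leq_pexp2l //; lia.
by rewrite expnM; case: c {c3} => // c; rewrite leq_exp2r // expnS expn1; nia.
Qed.

Lemma pbounded_poly f : pbounded f <-> exists c, forall n, f n <= poly_bound c n.
Proof.
split=> -[c fP].
  by exists (3 ^ c) => n; apply: leq_trans (fP n) (pow_poly_bound _ _).
by exists c.+1 => n; apply: leq_trans (fP n) (poly_bound_pow _ _).
Qed.

Lemma pb_le f g : pbounded g -> (forall n, f n <= g n) -> pbounded f.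
Proof. by move=> [c gP] le_fg; exists c => n; apply: leq_trans (le_fg n) (gP n).
    Qed.

Lemma pb_const k : pbounded (fun=> k).
Proof.
exists k => n; apply: leq_trans (ltnW (ltn_expl k (isT : 1 < 2))) _.
by case: k => // k; rewrite leq_exp2r // leq_addl.
Qed.

Lemma pb_id : pbounded (fun n => n).
Proof. by exists 1 => n; rewrite expn1 leq_addr. Qed.

Lemma pb_add f g : pbounded f -> pbounded g -> pbounded (fun n => f n + g n).
Proof.
move=> [a fP] [b gP]; exists (maxn a b).+1 => n.
have := leq_trans (fP n) (leq_pow2 n (leq_maxl a b)).
have := leq_trans (gP n) (leq_pow2 n (leq_maxr a b)).
rewrite expnS; nia.
Qed.

Lemma pb_mul f g : pbounded f -> pbounded g -> pbounded (fun n => f n * g n).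
Proof.
by move=> [a fP] [b gP]; exists (a + b) => n; rewrite expnD leq_mul.
Qed.

Lemma pb_succ f : pbounded f -> pbounded (fun n => (f n).+1).
Proof. by move=> fP; apply: pb_le (pb_add (pb_const 1) fP) _ => n; rewrite add1n.
    Qed.

Lemma pb_double f : pbounded f -> pbounded (fun n => (f n).*2).
Proof. by move=> fP; apply: pb_le (pb_add fP fP) _ => n; rewrite addnn. Qed.

Lemma pb_comp g f : pbounded g -> pbounded f -> pbounded (fun n => g (f n)).
Proof.
(* The exponent comes from [f n + 2 <= (n + 2) ^ a + 2 <= (n + 2) ^ (a + 2)]. *)
move=> [c gP] [a fP]; exists ((a + 2) * c) => n.
apply: leq_trans (gP _) _; rewrite expnM; case: c {gP} => // c.
rewrite leq_exp2r //; have := fP n.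
have : 0 < (n + 2) ^ a by rewrite expn_gt0 addn2.
rewrite expnD !expnS expn0; nia.
Qed.

Lemma pb_poly c f : pbounded f -> pbounded (fun n => poly_bound c (f n)).
Proof. by apply: pb_comp; exists c.+1 => n; apply: poly_bound_pow. Qed.

Ltac pb := repeat first
  [ exact: pb_id | exact: pb_const | assumption | apply: pb_poly | apply: pb_succ
  | apply: pb_double | apply: pb_add | apply: pb_mul ].

(** * A machine that evaluates formulas *)

Definition reach (M : TM) (k : nat) (c c' : config M) : Prop :=
  exists2 j, j <= k & iter j (@step M) c = c'.

Lemma reach_refl M (c : config M) : reach 0 c c.
Proof. by exists 0. Qed.

Lemma reach_trans M k1 k2 (c1 c2 c3 : config M) :
  reach k1 c1 c2 -> reach k2 c2 c3 -> reach (k1 + k2) c1 c3.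
Proof.
move=> [j1 le1 <-] [j2 le2 <-]; exists (j2 + j1); last by rewrite iterD.
by rewrite addnC leq_add.
Qed.

Lemma reach_step M k (c c' : config M) :
  reach k (step c) c' -> reach k.+1 c c'.
Proof. by move=> [j le_jk <-]; exists j.+1; rewrite ?ltnS // iterSr. Qed.

Lemma reach_le M k k' (c c' : config M) : k <= k' -> reach k c c' -> reach k' c c'.
Proof. by move=> le_k [j le_j <-]; exists j => //; apply: leq_trans le_k. Qed.

Lemma iter_halt M (c : config M) k : tm_halt c.1 -> iter k (@step M) c = c.
Proof. by move=> hc; elim: k => //= k ->; rewrite /step hc. Qed.

Lemma reach_halt M k (c c' : config M) :
  reach k c c' -> tm_halt c'.1 -> iter k (@step M) c = c'.
Proof.
by move=> [j le_jk <-] hc; rewrite -(subnK le_jk) iterD iter_halt.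
Qed.

(* The only machine programmed here. On [pair_code (pair_code x a) w] it copies
   [x ++ w] to tape 1 and [a] to tape 2, then reads [a] as a matrix of rows
   [pair_code mask [:: ex]] and checks for each row how many bits of [x ++ w]
   the mask selects: exactly one if [ex], at least one otherwise. The optional
   bit in [CA] and [CB] is this count, cut off at two. [S0]-[S3] read [x], four
   cells per bit, [A0]-[A1] read [a], two cells per bit, [Wt] reads [w], and
   [R2], [R1] rewind tapes 2 and 1. *)

Inductive ck_state :=
  | S0 | S1 | S2 | S3 | A0 | A1 | Wt | R2 | R1
  | CA of option bool | CB of option bool & bool | Accept | Reject.

(** An injection into a finite type, from which [ck_state] inherits its [finType] structure. *)
Definition ck_code (q : ck_state) : 'I_13 * option bool * bool :=
  match q with
  | S0 => (inord 0, None, false) | S1 => (inord 1, None, false)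
  | S2 => (inord 2, None, false) | S3 => (inord 3, None, false)
  | A0 => (inord 4, None, false) | A1 => (inord 5, None, false)
  | Wt => (inord 6, None, false) | R2 => (inord 7, None, false)
  | R1 => (inord 8, None, false) | CA n => (inord 9, n, false)
  | CB n c => (inord 10, n, c) | Accept => (inord 11, None, false)
  | Reject => (inord 12, None, false)
  end.

Definition ck_decode (p : 'I_13 * option bool * bool) : ck_state :=
  let: (i, n, c) := p in
  match nat_of_ord i with
  | 0 => S0 | 1 => S1 | 2 => S2 | 3 => S3 | 4 => A0 | 5 => A1 | 6 => Wt
  | 7 => R2 | 8 => R1 | 9 => CA n | 10 => CB n c | 11 => Accept | _ => Reject
  end.

Lemma ck_codeK : cancel ck_code ck_decode.
Proof. by case=> // *; rewrite /ck_decode /= inordK. Qed.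

HB.instance Definition _ := Finite.copy ck_state (can_type ck_codeK).

Notation vcell := (cell void).

Definition bt (b : bool) : vcell := Some (inl b).

Definition unbit (S : finType) (c : cell S) : option bool :=
  if c is Some (inl b) then Some b else None.

(** [None], [Some false] and [Some true] stand for zero, one and at least two. *)
Definition bump_count (n : option bool) (b : bool) : option bool :=
  if b then Some (n != None) else n.

Definition count_ok (ex : bool) (n : option bool) : bool :=
  if ex then n == Some false else n != None.

Definition ck_delta (q : ck_state) (s0 s1 s2 : vcell) :
    ck_state * (vcell * move) * (vcell * move) * (vcell * move) :=
  let z0 := (s0, Stay) in let z1 := (s1, Stay) in let z2 := (s2, Stay) in
  let r0 := (s0, Right) in
  let rej := (Reject, z0, z1, z2) in
  match q with
  | S0 => if unbit s0 is Some true then (S1, r0, z1, z2) else rej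
  | S1 => if unbit s0 is Some b then (if b then S2 else A0, r0, z1, z2) else rej
  | S2 => if unbit s0 is Some true then (S3, r0, z1, z2) else rej
  | S3 => if unbit s0 is Some b then (S0, r0, (s0, Right), z2) else rej
  | A0 => if unbit s0 is Some b then (if b then A1 else Wt, r0, z1, z2) else rej
  | A1 => if unbit s0 is Some b then (A0, r0, z1, (s0, Right)) else rej
  | Wt => if unbit s0 is Some b then (Wt, r0, (s0, Right), z2)
          else (R2, z0, z1, (s2, Left))
  | R2 => if unbit s2 is Some b then (R2, z0, z1, (s2, Left))
          else (R1, z0, (s1, Left), (s2, Right))
  | R1 => if unbit s1 is Some b then (R1, z0, (s1, Left), z2)
          else (CA None, z0, (s1, Right), z2)
  | CA n => if unbit s2 is Some c then (CB n c, z0, z1, (s2, Right))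
            else (Accept, (bt true, Stay), z1, z2)
  | CB n c =>
      if unbit s2 is Some m then
        if c then
          if unbit s1 is Some b
          then (CA (bump_count n (m && b)), z0, (s1, Right), (s2, Right))
          else rej
        else if unbit s1 is None
             then if count_ok m n then (R1, z0, (s1, Left), (s2, Right)) else rej
             else rej
      else rej
  | Accept | Reject => rej
  end.

Definition triple (T : Type) (x0 x1 x2 : T) : {ffun 'I_3 -> T} :=
  [ffun i => nth x0 [:: x0; x1; x2] (nat_of_ord i)].

Definition checker : TM := @MkTM 2 void ck_state S0
  (fun q => match q with Accept | Reject => true | _ => false end)
  (fun q s =>
     let: (q', a0, a1, a2) :=
       ck_delta q (s ord0) (s (inord 1)) (s (inord 2)) in
     (q', triple a0 a1 a2)).

Definition cfg (q : ck_state) (t0 t1 t2 : tape void) : config checker :=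
  (q, triple t0 t1 t2).

Definition bits (s : seq bool) : seq vcell := [seq bt b | b <- s].

(** * Runs of the checker: parsing, rewinding, evaluating *)

Lemma step_cfg q t0 t1 t2 :
  step (cfg q t0 t1 t2) =
  match q with Accept | Reject => cfg q t0 t1 t2 | _ =>
    let: (q', a0, a1, a2) := ck_delta q (scanned t0) (scanned t1) (scanned t2) in
    cfg q' (act t0 a0) (act t1 a1) (act t2 a2) end.
Proof.
have E : forall q, ~~ (if q is (Accept | Reject) then true else false) ->
    step (cfg q t0 t1 t2) = 
    let: (q', a0, a1, a2) := ck_delta q (scanned t0) (scanned t1) (scanned t2) in
    cfg q' (act t0 a0) (act t1 a1) (act t2 a2).
  move=> p /negbTE hp; rewrite /step /= hp /= !ffunE /= !inordK //=.
  case: (ck_delta _ _ _ _) => [[[q' a0] a1] a2] /=; congr pair.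
  by apply/ffunP => -[[|[|[|i]]] //= hi]; rewrite !ffunE.
by case: q => [] *; first [by rewrite E | by []].
Qed.

Lemma init_cfg x : init checker x = cfg S0 ([::], bits x) ([::], [::]) ([::], [::]).
Proof.
by congr pair; apply/ffunP => -[[|[|[|i]]] //= hi]; rewrite !ffunE.
Qed.

(** The reading states as a function: [u] and [v] are what tapes 1 and 2 hold so far. A bit of [x]
    takes four cells because it carries an inner marker and each of these two bits carries an outer
    one. *)
Fixpoint parse (q : ck_state) (u v r : seq bool) : option (seq bool * seq bool) :=
  if r is b :: r' then
    match q with
    | S0 => if b then parse S1 u v r' else None
    | S1 => parse (if b then S2 else A0) u v r'
    | S2 => if b then parse S3 u v r' else None
    | S3 => parse S0 (rcons u b) v r'
    | A0 => parse (if b then A1 else Wt) u v r'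
    | A1 => parse A0 u (rcons v b) r'
    | Wt => parse Wt (rcons u b) v r'
    | _ => None
    end
  else if q is Wt then Some (u, v) else None.

Definition parsing (q : ck_state) : bool :=
  match q with S0 | S1 | S2 | S3 | A0 | A1 | Wt => true | _ => false end.

(** An empty right part becomes an explicit blank after a [Stay] and is empty again after a [Right];
    the boolean keeps track of the two forms. *)
Definition blanks (b : bool) : seq vcell := nseq b None.

(** The last move on tape 2 is left as an [act], the form in which [rewind2] starts. *)
Lemma parse_run r q u v l b1 b2 : parsing q ->
  let c := cfg q (l, bits r) (rev (bits u), blanks b1) (rev (bits v), blanks b2) in
  match parse q u v r with
  | Some (u', v') => exists l', reach (size r).+1 c
      (cfg R2 (l', [:: None]) (rev (bits u'), [:: None])
          (act (rev (bits v'), [::]) (None, Left)))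
  | None => exists2 c' : config checker, reach (size r).+1 c c' & tm_halt c'.1
  end.
Proof.
have st L b : act (L, blanks b) (None, Stay) = (L, blanks true) by case: b.
have ri L b x : act (L, blanks b) (bt x, Right) = (bt x :: L, blanks false).
  by case: b.
have sc L b : scanned (L, blanks b) = None by case: b.
elim: r q u v l b1 b2 => [|b r IH] q u v l b1 b2 pq c.
  have {c}-> : reach 1 c = reach 1 (cfg q (l, [::]) (rev (bits u), blanks b1)
        (rev (bits v), blanks b2)) by [].
  case: q pq => // _ /=; try (eexists; [apply: reach_step; rewrite step_cfg /=;
      exact: reach_refl | by []]).
  exists l; apply: reach_step; rewrite step_cfg /= !sc /= st.
  by case: b2; apply: reach_refl.
have K q' u' v' l' b1' b2' : parsing q' -> 
  step c = cfg q' (l', bits r) (rev (bits u'), blanks b1') (rev (bits v'), blanks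
      b2') ->
  match parse q' u' v' r with
  | Some (u', v') => exists l', reach (size r).+2 c
      (cfg R2 (l', [:: None]) (rev (bits u'), [:: None])
          (act (rev (bits v'), [::]) (None, Left)))
  | None => exists2 c' : config checker, reach (size r).+2 c c' & tm_halt c'.1
  end.
  move=> pq' Ec; move: (IH q' u' v' l' b1' b2' pq') => /=; rewrite -Ec.
  case: (parse _ _ _ _) => [[u2 v2] [l2 H] | [c2 H hc]].
    by exists l2; apply: reach_step.
  by exists c2 => //; apply: reach_step.
have Rj q' t0 t1 t2 : step c = cfg Reject t0 t1 t2 -> parse q' u v r = None ->
  exists2 c' : config checker, reach (size r).+2 c c' & tm_halt c'.1.
  by move=> Ec _; exists (step c); [exists 1 | rewrite Ec].
case: q pq @c K Rj => // _ c K Rj; rewrite [parse _ _ _ _]/=.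
- by case: b @c K Rj => c K Rj; [apply: K; rewrite /c // step_cfg /= !sc /= !st |
    eapply (Rj Reject); [rewrite /c step_cfg //= | case: (r)]].
- by apply: (K (if b then S2 else A0)); [case: (b) | rewrite /c step_cfg /= !sc /=
    !st].
- by case: b @c K Rj => c K Rj; [apply: K; rewrite /c // step_cfg /= !sc /= !st |
    eapply (Rj Reject); [rewrite /c step_cfg //= | case: (r)]].
- by apply: K; rewrite /c // step_cfg /= !sc /= /bits map_rcons rev_rcons ri st.
- by apply: (K (if b then A1 else Wt)); [case: (b) | rewrite /c step_cfg /= !sc /=
    !st].
- by apply: K; rewrite /c // step_cfg /= !sc /= /bits map_rcons rev_rcons ri st.
- by apply: K; rewrite /c // step_cfg /= !sc /= /bits map_rcons rev_rcons ri st.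
Qed.

Lemma parse_size r q u v u' v' :
  parse q u v r = Some (u', v') -> size u' + size v' <= size u + size v + size r.
Proof.
elim: r q u v => [|b r IH] q u v /=; first by case: q => //= -[<- <-]; rewrite
    addn0.
case: q => // H; rewrite addnS.
all: try (case: b H => // H; exact: leqW (IH _ _ _ H)).
all: by have := IH _ _ _ H; rewrite size_rcons; lia.
Qed.

Lemma parse_pair x a w :
  parse S0 [::] [::] (pair_code (pair_code x a) w) = Some (x ++ w, a).
Proof.
have Ew u v : parse Wt u v w = Some (u ++ w, v).
  by elim: w u => [|b w IH] u /=; rewrite ?cats0 // IH cat_rcons.
have Ea u v : parse A0 u v (pair_code a w) = Some (u ++ w, v ++ a).
  elim: a v => [|b a IH] v /=; first by rewrite Ew cats0.
  by rewrite -/(pair_code a w) IH cat_rcons.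
have Ex u : parse S0 u [::] (pair_code (pair_code x a) w) = Some (u ++ x ++ w, a).
  elim: x u => [|b x IH] u /=; first by rewrite -/(pair_code a w) Ea.
  by rewrite -/(pair_code x a) -/(pair_code (pair_code x a) w) IH cat_rcons.
exact: Ex.
Qed.

(** The hypothesis says that the right part of tape 2 is nonempty, so that a [Stay] leaves that tape
    literally unchanged. Starting from a pending move to the left makes each induction step one such
    move. *)
Lemma rewind1 V y r b l t2 : scanned t2 :: behead t2.2 = t2.2 ->
  reach (size V).+1
    (cfg R1 (l, [:: None]) (act (bits V ++ blanks b, r) (y, Left)) t2)
    (cfg (CA None) (l, [:: None]) ([:: None], rev (bits V) ++ y :: behead r) t2).
Proof.
case: t2 => l2 r2 /= h2.
rewrite /scanned /= in h2.
elim: V y r => [|x V IH] y r; apply: reach_step; rewrite step_cfg /act /scanned /=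
    ?h2.
  by case: b; rewrite /= ?h2; apply: reach_refl.
have := IH (bt x) (bt x :: y :: behead r).
by rewrite /= rev_cons cat_rcons.
Qed.

Lemma rewind2 V y r b l t1 : scanned t1 :: behead t1.2 = t1.2 ->
  reach (size V).+1
    (cfg R2 (l, [:: None]) t1 (act (bits V ++ blanks b, r) (y, Left)))
    (cfg R1 (l, [:: None]) (act t1 (scanned t1, Left))
         ([:: None], rev (bits V) ++ y :: behead r)).
Proof.
case: t1 => l1 r1 /= h1.
rewrite /scanned /= in h1.
elim: V y r => [|x V IH] y r; apply: reach_step; rewrite step_cfg /act /scanned /=
    ?h1.
  by case: b; rewrite /= ?h1; apply: reach_refl.
have := IH (bt x) (bt x :: y :: behead r).
by rewrite /act /scanned /= h1 rev_cons cat_rcons.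
Qed.

(** The evaluation of the matrix as a function: [z] is the whole assignment, [rest] its part from
    the head of tape 1 on. A mask longer or shorter than [z] is rejected. *)
Fixpoint check_rows (z rest : seq bool) (n : option bool) (a : seq bool) : bool :=
  match a with
  | c :: m :: a' =>
      if c then if rest is b :: rest'
                then check_rows z rest' (bump_count n (m && b)) a' else false
      else nilp rest && count_ok m n && check_rows z z None a'
  | [::] => true
  | _ => false
  end.

(** Two cells of [a] cost two steps and, at the end of a row, a rewind in [size z + 1] steps. The
    induction is on a bound for [size a], which drops by two. *)
Lemma check_run k a z u rest n l l2 : size a <= k -> u ++ rest = z ->
  exists c' : config checker,
  [/\ reach (size a * (size z + 4)).+1
        (cfg (CA n) (l, [:: None]) (rev (bits u) ++ [:: None], bits rest ++ [::
            None])
             (l2, bits a ++ [:: None])) c',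
      tm_halt c'.1
    & output c' = if check_rows z rest n a then [:: true] else [::]].
Proof.
elim: k a u rest n l2 => [|k IH] a u rest n l2.
  case: a => // _ Ez /=; eexists; split; first by apply: reach_step; rewrite
      step_cfg; apply: reach_refl.
    by [].
  by rewrite /output /= ffunE.
case: a => [_ _|c [|m a]] /=.
- by eexists; split; [apply: reach_step; rewrite step_cfg; apply: reach_refl | |
    rewrite /output /= ffunE].
- move=> _ Ez; eexists; split.
  + apply: (@reach_le _ 2); first by lia.
    by apply: reach_step; rewrite step_cfg /=; apply: reach_step; rewrite step_cfg
        /=; apply: reach_refl.
  + by [].
  + by rewrite /output /= ffunE.
rewrite ltnS => /ltnW ha Ez.
have rej : forall q t1 t2 t1' t2', 
   step (cfg (CA n) (l, [:: None]) t1 t2) = cfg q (l, [:: None]) t1' t2' ->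
   (exists t1 t2, step (cfg q (l, [:: None]) t1' t2') = cfg Reject (l, [:: None])
       t1 t2) ->
  exists c' : config checker,
  [/\ reach (((size a).+2) * (size z + 4)).+1
        (cfg (CA n) (l, [:: None]) t1 t2) c',
      tm_halt c'.1 & output c' = [::]].
  move=> q t1 t2 t1' t2' E1 [t3 [t4 E2]]; exists (cfg Reject (l, [:: None]) t3 t4);
      split=> //.
    apply: (@reach_le _ 2); first by lia.
    by apply: reach_step; rewrite E1; apply: reach_step; rewrite E2; apply:
        reach_refl.
  by rewrite /output /= ffunE.
have E1 : step (cfg (CA n) (l, [:: None]) (rev (bits u) ++ [:: None], bits rest ++
    [:: None])
             (l2, bits [:: c, m & a] ++ [:: None])) =
   cfg (CB n c) (l, [:: None]) (rev (bits u) ++ [:: None], bits rest ++ [:: None])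
             (bt c :: l2, bits (m :: a) ++ [:: None]).
  by rewrite step_cfg /=; case: (rest).
case: c E1 => E1.
  case: rest Ez E1 => [|b rest] Ez E1.
    apply: rej; first exact: E1.
    by rewrite step_cfg /=; do 2 eexists.
  have [|c' [r' h' o']] := IH a (rcons u b) rest (bump_count n (m && b)) (bt m ::
      bt true :: l2) ha.
    by rewrite cat_rcons.
  exists c'; split=> //; apply: (@reach_le _ ((size a * (size z + 4)).+1).+2);
      first by lia.
  apply: reach_step; rewrite E1; apply: reach_step; rewrite step_cfg /=.
  by move: r'; rewrite /bits map_rcons rev_rcons.
case: rest Ez E1 => [|b rest] Ez E1 /=; last first.
  apply: rej; first exact: E1.
  by rewrite step_cfg /=; do 2 eexists.
case ok : (count_ok m n) => /=; last first.
  apply: rej; first exact: E1.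
  by rewrite step_cfg /= ok; do 2 eexists.
have [//|c' [r' h' o']] := IH a [::] z None (bt m :: bt false :: l2) ha.
exists c'; split=> //.
apply: (@reach_le _ (((size (rev u)).+1 + (size a * (size z + 4)).+1)).+2).
  by rewrite -Ez size_rev size_cat /=; lia.
apply: reach_step; rewrite E1; apply: reach_step; rewrite step_cfg /= ok.
apply: reach_trans r'; rewrite /bits -map_rev.
have := @rewind1 (rev u) None [:: None] true l (bt m :: bt false :: l2, bits a ++
    [:: None]).
rewrite /= /bits -!map_rev revK -Ez cats0; apply.
by case: (a).
Qed.

Lemma checker_run x : exists c' : config checker,
  [/\ reach ((size x + 2) ^ 3) (init checker x) c', tm_halt c'.1
    & forall z a, parse S0 [::] [::] x = Some (z, a) ->
      output c' = if check_rows z z None a then [:: true] else [::]].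
Proof.
rewrite init_cfg; have /= := @parse_run x S0 [::] [::] [::] false false isT.
case E: (parse S0 [::] [::] x) => [p|]; last first.
  by case=> c' rc hc; exists c'; split=> //; apply: reach_le rc; rewrite !expnS;
      nia.
case: p E => z a E [l P].
have := parse_size E; rewrite /= add0n => sz.
have [c' [rc hc oc]] := @check_run _ a z [::] z None l [:: None] (leqnn _) erefl.
exists c'; split=> //; last by move=> z' a' [<- <-].
have Q2 : reach (size a).+1
    (cfg R2 (l, [:: None]) (rev (bits z), [:: None]) (act (rev (bits a), [::])
        (None, Left)))
    (cfg R1 (l, [:: None]) (act (rev (bits z), [:: None]) (None, Left))
         ([:: None], bits a ++ [:: None])).
  have := @rewind2 (rev a) None [::] false l (rev (bits z), [:: None]) erefl.
  by rewrite cats0 /bits -!map_rev revK size_rev.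
have Q1 : reach (size z).+1
    (cfg R1 (l, [:: None]) (act (rev (bits z), [:: None]) (None, Left))
         ([:: None], bits a ++ [:: None]))
    (cfg (CA None) (l, [:: None]) ([:: None], bits z ++ [:: None])
         ([:: None], bits a ++ [:: None])).
  have := @rewind1 (rev z) None [:: None] false l ([:: None], bits a ++ [:: None]).
  by rewrite cats0 /bits -!map_rev revK size_rev; apply; case: (a).
have := reach_trans P (reach_trans Q2 (reach_trans Q1 rc)).
apply: reach_le; rewrite !expnS expn0; nia.
Qed.

(** The constant is [3 ^ 3], by which [pow_poly_bound] absorbs the running time
    [(size x + 2) ^ 3]. *)
Definition check_lang : language := fun x =>
  output (iter (poly_bound 27 (size x)) (@step checker) (init checker x)) = [::
      true].

Lemma check_lang_in_P : in_P check_lang.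
Proof.
exists (fun x => output (iter (poly_bound 27 (size x)) (@step checker) (init
    checker x))).
split=> //; exists checker, 27 => x; split=> //.
have [c' [rc hc _]] := checker_run x.
have {}rc := reach_le (pow_poly_bound 3 _) rc.
by rewrite (reach_halt rc hc).
Qed.

Lemma check_langP x a w :
  check_lang (pair_code (pair_code x a) w) <-> check_rows (x ++ w) (x ++ w) None a.
Proof.
rewrite /check_lang; have [c' [rc hc oc]] := checker_run (pair_code (pair_code x a)
    w).
have {}rc := reach_le (pow_poly_bound 3 _) rc.
rewrite (reach_halt rc hc) (oc _ _ (parse_pair x a w)).
by case: (check_rows _ _ _ _).
Qed.

(** * Multi-valued formulas as advice *)

(* A multi-valued CNF: each node of [N] takes a value in [A], and a clause
   lists, for each node, the values that satisfy it. *)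
Definition clause (N A : finType) := N -> pred A.

Definition csat (N A : finType) (s : N -> A) (c : clause N A) : bool :=
  [exists n, c n (s n)].

Lemma all_flatten (T : Type) (p : pred T) ss : all p (flatten ss) = all (all p) ss.
Proof. by elim: ss => //= t ss IH; rewrite all_cat IH. Qed.

Section Expressible.
Variables N A : finType.
Implicit Types (P : (N -> A) -> Prop) (s : N -> A).

(** Only clauses are counted, whatever their length: each will be a single row of the matrix or a
    single vertex of the graph, with its leaf and its dummy. *)
Definition expressible (r : nat) P : Prop :=
  exists2 phi : seq (clause N A), size phi <= r & forall s, all (csat s) phi <-> P
      s.

Lemma expr_le r r' P : expressible r P -> r <= r' -> expressible r' P.
Proof. by move=> [phi le_phi phiP] le_r; exists phi => //; apply: leq_trans le_r.
    Qed.

Lemma expr_ext r P P' : (forall s, P s <-> P' s) -> expressible r P -> expressible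
    r P'.
Proof.
by move=> eqP [phi le_phi phiP]; exists phi => // s; apply: iff_trans (phiP s) (eqP
    s).
Qed.

Lemma expr_true : expressible 0 (fun=> True).
Proof. by exists [::]. Qed.

Lemma expr_lit n (p : pred A) : expressible 1 (fun s => p (s n)).
Proof.
exists [:: fun m a => (m == n) && p a] => // s; rewrite /= andbT.
by split=> [/existsP[m /andP[/eqP->]] | pn] //; apply/existsP; exists n; rewrite
    eqxx.
Qed.

Lemma expr_and r1 r2 P1 P2 :
  expressible r1 P1 -> expressible r2 P2 ->
  expressible (r1 + r2) (fun s => P1 s /\ P2 s).
Proof.
move=> [f1 le1 f1P] [f2 le2 f2P]; exists (f1 ++ f2).
  by rewrite size_cat leq_add.
move=> s; rewrite all_cat; split=> [/andP[/f1P ? /f2P ?] // | [/f1P -> /f2P ->]] //.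
Qed.

Lemma expr_forall (I : finType) r (P : I -> (N -> A) -> Prop) :
  (forall i, expressible r (P i)) -> expressible (#|I| * r) (fun s => forall i, P i
      s).
Proof.
move=> PI; have [phi le_phi phiP] := fin_all_exists2 PI.
exists (flatten [seq phi i | i <- enum I]).
  rewrite size_flatten /shape -map_comp sumnE big_map big_enum /= -sum_nat_const.
  exact: leq_sum.
move=> s; rewrite all_flatten all_map; split=> [/allP H i | H].
  by apply/phiP/H; rewrite mem_enum.
by apply/allP => i _; apply/phiP/H.
Qed.

(** Allowing, in every clause, the values of node [n] outside [p] adds a guard without adding a
    clause. *)
Lemma expr_imply r n (p : pred A) P :
  expressible r P -> expressible r (fun s => p (s n) -> P s).
Proof.
move=> [phi le_phi phiP].
exists [seq (fun m a => (m == n) && ~~ p a || c m a) | c : clause N A <- phi].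
  by rewrite size_map.
move=> s; rewrite all_map.
have E c : csat s (fun m a => (m == n) && ~~ p a || c m a) = (p (s n) ==> csat s c).
  rewrite /csat; case pn: (p (s n)) => /=.
    by apply: eq_existsb => m; case: eqP => // ->; rewrite pn.
  by apply/existsP; exists n; rewrite eqxx pn.
rewrite (eq_all E); split=> [H pn | H].
  by apply/phiP; move: H; rewrite pn.
case pn: (p (s n)); last by elim: (phi).
by apply/phiP/H.
Qed.

(** A guarded case split over the value read. The cost depends on [V] and not on [A], which matters
    once [A] grows with the number of inputs. *)
Lemma expr_read (V : finType) r n (h : A -> V) (Q : V -> (N -> A) -> Prop) :
  (forall v, expressible r (Q v)) ->
  expressible (#|V| * r) (fun s => Q (h (s n)) s).
Proof.
move=> QE; apply: (@expr_ext _ (fun s => forall v, h (s n) == v -> Q v s)).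
  by move=> s; split=> [H | H v /eqP <-] //; apply: H.
by apply: expr_forall => v; apply: (@expr_imply _ _ (fun a => h a == v)).
Qed.

Lemma expr_reads (I V : finType) r (nd : I -> N) (h : A -> V)
    (Q : {ffun I -> V} -> (N -> A) -> Prop) :
  (forall v, expressible r (Q v)) ->
  expressible (#|V| ^ #|I| * r) (fun s => Q [ffun i => h (s (nd i))] s).
Proof.
move=> QE; rewrite -card_ffun.
apply: (@expr_ext _ (fun s => forall v : {ffun I -> V},
   (forall i, i \in enum I -> h (s (nd i)) == v i) -> Q v s)).
  move=> s; split=> [H | H v Hv]; first by apply: H => i; rewrite ffunE.
  suff <- : [ffun i => h (s (nd i))] = v by [].
  by apply/ffunP => i; rewrite ffunE; apply/eqP/Hv; rewrite mem_enum.
apply: expr_forall => v; elim: (enum I) => [|i e IH].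
  by apply: expr_ext (QE v) => s; split=> // H; apply: H.
apply: (expr_ext _ (@expr_imply _ (nd i) (fun a => h a == v i) _ IH)) => s.
split=> H.
  move=> Hi; apply: H; first by apply: Hi; rewrite mem_head.
  by move=> j je; apply: Hi; rewrite inE je orbT.
by move=> hi He; apply: H => j; rewrite inE => /predU1P[-> | /He].
Qed.

End Expressible.

(** * Matrices of rows, their codes, and the matrix of a formula *)

Definition mrow (C : Type) := (bool * pred C)%type.

Definition row_ok (C : finType) (zf : pred C) (r : mrow C) : bool :=
  let k := #|[pred c | r.2 c && zf c]| in if r.1 then k == 1 else 0 < k.

Section Matrix.
Variables (C : finType) (cols : seq C).
Hypothesis cols_enum : perm_eq cols (enum C).

Definition code_rows (rows : seq (mrow C)) : seq bool :=
  foldr (fun r a => pair_code [seq r.2 c | c <- cols] (r.1 :: a)) [::] rows.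

Lemma size_pair_code x y : size (pair_code x y) = (size x).*2 + (size y).+1.
Proof.
rewrite /pair_code size_cat /=; congr (_ + _).
by elim: x => //= b x ->; rewrite doubleS.
Qed.

Lemma size_code_rows rows : size (code_rows rows) = size rows * (#|C|.*2 + 2).
Proof.
elim: rows => //= r rows IH; rewrite size_pair_code /= IH size_map.
have -> : size cols = #|C| by rewrite (perm_size cols_enum) -cardE.
by rewrite mulSn; move: #|C| (size rows) => k m; lia.
Qed.

Definition cut_count (k : nat) : option bool :=
  match k with 0 => None | 1 => Some false | _ => Some true end.

Lemma check_rows_pair z rest k (mask : seq bool) ex a :
  check_rows z rest (cut_count k) (pair_code mask (ex :: a)) =
  [&& size rest == size mask,
      count_ok ex (cut_count (k + count (fun p => p.1 && p.2) (zip mask rest)))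
    & check_rows z z None a].
Proof.
elim: mask rest k => [|m mask IH] [|b rest] k //=; first by rewrite addn0.
rewrite -/(pair_code mask (ex :: a)).
have -> : bump_count (cut_count k) (m && b) = cut_count (k + (m && b)).
  by case: (m && b); case: k => [|[|k]]; rewrite ?addn0 ?addn1.
by rewrite IH eqSS addnA.
Qed.

Lemma count_cut ex k : count_ok ex (cut_count k) = if ex then k == 1 else 0 < k.
Proof. by case: ex; case: k => [|[|k]]. Qed.

Lemma check_code_rows (zf : pred C) rows :
  let z := [seq zf c | c <- cols] in
  check_rows z z None (code_rows rows) = all (row_ok zf) rows.
Proof.
move=> z; elim: rows => //= r rows IH.
rewrite -[None]/(cut_count 0) check_rows_pair IH !size_map eqxx /= count_cut.
congr (_ && _); rewrite /row_ok /z.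
suff -> : count (fun p => p.1 && p.2) (zip [seq r.2 c | c <- cols] [seq zf c | c <-
    cols])
  = #|[pred c | r.2 c && zf c]| by [].
rewrite cardE /enum_mem size_filter -enumT -(permP cols_enum).
by elim: (cols) => //= c e ->.
Qed.

Lemma check_code_rows_size z rows :
  0 < size rows -> check_rows z z None (code_rows rows) -> size z = size cols.
Proof.
case: rows => //= r rows _.
by rewrite -[None]/(cut_count 0) check_rows_pair size_map => /and3P[/eqP].
Qed.

End Matrix.

Section Certificate.
Variables (n : nat) (N A : finType) (phi : seq (clause N A)).
Variables (xn : 'I_n -> N) (xb : A -> bool).

Let C : finType := ('I_n + N * A)%type.

(** The input columns come first because the checker evaluates [x ++ w]. *)
Let cols : seq C := map inl (enum 'I_n) ++ map inr (enum {: N * A}).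

Lemma cols_enum : perm_eq cols (enum C).
Proof.
apply: uniq_perm; last 1 first.
- move=> [j | p]; rewrite mem_enum mem_cat.
    by rewrite map_f ?mem_enum.
  by rewrite [X in _ || X]map_f ?orbT ?mem_enum.
- rewrite cat_uniq (map_inj_uniq inl_inj) (map_inj_uniq inr_inj) !enum_uniq andbT.
  by apply/hasPn => _ /mapP[p _ ->]; apply/mapP => -[].
- exact: enum_uniq.
Qed.

Definition group_row (m : N) : mrow C :=
  (true, fun c => if c is inr (m', _) then m' == m else false).

(** Once [Z] is the graph of a function, this row counts bit [j] of [x] plus one if node [xn j]
    carries the bit [false]. The count is one exactly when the two bits agree. *)
Definition input_row (j : 'I_n) : mrow C :=
  (true, fun c => match c with inl j' => j' == j
                  | inr (m, a) => (m == xn j) && ~~ xb a end).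

Definition clause_row (cl : clause N A) : mrow C :=
  (false, fun c => if c is inr (m, a) then cl m a else false).

Definition certificate_rows : seq (mrow C) :=
  [seq group_row m | m <- enum N] ++ [seq input_row j | j <- enum 'I_n]
  ++ [seq clause_row cl | cl <- phi].

Definition col_value (x : n.-tuple bool) (Z : pred (N * A)) : pred C :=
  fun c => match c with inl j => tnth x j | inr p => Z p end.

Lemma map_col_value x Z :
  [seq col_value x Z c | c <- cols] = x ++ [seq Z p | p <- enum {: N * A}].
Proof.
rewrite map_cat -(map_comp _ inr) -(map_comp _ inl); congr (_ ++ _).
by rewrite -[RHS](map_tnth_enum x); apply: eq_map.
Qed.

(** The group rows make [Z] the graph of an assignment [s], the input rows tie [s] to [x], and the
    clause rows are the clauses. *)
Lemma certificate_rowsP x :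
  (exists Z, all (row_ok (col_value x Z)) certificate_rows) <->
  (exists s : N -> A, all (csat s) phi /\ forall j, xb (s (xn j)) = tnth x j).
Proof.
have clauseE (s : N -> A) (Z : pred (N * A)) : (forall m b, Z (m, b) = (b == s m))
    ->
    all (fun cl => row_ok (col_value x Z) (clause_row cl)) phi = all (csat s) phi.
  move=> sP; apply: eq_all => cl; apply/card_gt0P/existsP => -[].
    by move=> [j | [m a]] //; rewrite !inE /= => /andP[cla]; rewrite sP => /eqP
        as_m; exists m; rewrite -as_m.
  by move=> m clm; exists (inr (m, s m)); rewrite !inE /= clm sP eqxx.
split=> [[Z] | [s [sphi sx]]].
  rewrite !all_cat => /and3P[G X F]; move: G X F.
  rewrite all_map => /allP G; rewrite all_map => /allP X; rewrite all_map => F.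
  have /fin_all_exists[s sP] : forall m, exists a, forall b, Z (m, b) = (b == a).
    have mI m : m \in enum N by rewrite mem_enum.
    move=> m; have /eqP/mem_card1[c cP] := G m (mI m).
    have := cP c; rewrite !inE eqxx /=; case: c cP => // -[m' a] cP /andP[/eqP Em
        _].
    exists a => b; have := cP (inr (m, b)); rewrite !inE /= eqxx /= => ->.
    by rewrite -Em; apply/eqP/eqP => [[] | ->].
  exists s; split=> [|j]; first by rewrite -(clauseE s Z).
  have jI : j \in enum 'I_n by rewrite mem_enum.
  have /eqP/mem_card1[c cP] := X j jI.
  have := cP (inl j); have := cP (inr (xn j, s (xn j))).
  rewrite !inE /= !eqxx /= sP eqxx andbT.
  case xj: (tnth x j); case xbj: (xb _) => //.
    by move=> /esym/eqP <- /esym/eqP.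
  have := cP c; rewrite !inE eqxx /=; case: c cP => [j' | [m a]] cP /andP[].
    by move=> /= /eqP ->; rewrite xj.
  by move=> /= /andP[/eqP -> /negbTE xba]; rewrite sP => /eqP Ea; rewrite -Ea xba
      in xbj.
exists (fun p => p.2 == s p.1).
rewrite !all_cat; apply/and3P; split; rewrite all_map.
- apply/allP => m _ /=; apply/eqP/(@eq_card1 _ (inr (m, s m))).
  move=> [j | [m' a]]; rewrite !inE //=.
  by apply/andP/eqP => [[/eqP -> /eqP ->] | [-> ->]].
- apply/allP => j _ /=; apply/eqP.
  apply: (@eq_card1 _ (if tnth x j then inl j else inr (xn j, s (xn j)))).
  move=> [j' | [m a]]; rewrite !inE /=.
    case xj: (tnth x j); last by case: eqP => //= ->.
    by apply/andP/eqP => [[/eqP ->] | [->]].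
  rewrite -andbA andbC -andbA; case xj: (tnth x j).
    by apply/negbTE/and3P => -[xba /eqP Ea /eqP Em]; rewrite Ea Em sx xj in xba.
  apply/and3P/eqP => [[_ /eqP -> /eqP ->] // | [-> ->]].
  by rewrite sx xj !eqxx.
- by rewrite (clauseE s).
Qed.

End Certificate.

(** The advice for length [n] is the code of the matrix, and the witness is the selection [Z]. The
    formulas describe the complement of [L], so [L] itself is decided by the negation of a
    certificate language in NP. *)
Lemma advice_of_mcnf (L : language) (kappa : nat -> nat) :
  pbounded kappa ->
  (forall n, exists (N A : finType) (phi : seq (clause N A)) (xn : 'I_n -> N)
                    (xb : A -> bool),
     [/\ 0 < #|N|, #|N| <= kappa n, #|A| <= kappa n, size phi <= kappa n
       & forall x : n.-tuple bool,
         (exists s : N -> A, all (csat s) phi /\ forall j, xb (s (xn j)) = tnth x j)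
         <-> ~ L x]) ->
  with_poly_advice in_coNP L.
Proof.
move=> pb_kappa H.
pose cert z := exists w, size w <= poly_bound 1 (size z) /\ check_lang (pair_code z
    w).
pose B n := (kappa n + n + kappa n) * ((n + kappa n * kappa n).*2 + 2).
have [c cP] : exists c, forall n, B n <= poly_bound c n.
  by apply/pbounded_poly; rewrite /B; pb.
have adv n : {a | size a <= B n /\ forall x : n.-tuple bool, cert (pair_code x a)
    <-> ~ L x}.
  apply: constructive_indefinite_description.
  have [N [A [phi [xn [xb [N0 leN leA le_phi xP]]]]]] := H n.
  pose rows := certificate_rows phi xn xb.
  have size_rows : size rows = #|N| + n + size phi.
    rewrite /rows /certificate_rows !size_cat (size_map _ (enum N)) (size_map _
        (enum 'I_n)).
    by rewrite (size_map _ phi) size_enum_ord -cardE addnA.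
  have cols_enum := @cols_enum n N A.
  set cols := (map _ _ ++ _) in cols_enum.
  have size_cols : size cols = n + size (enum {: N * A}).
    by rewrite size_cat (size_map _ (enum 'I_n)) (size_map _ (enum {: N * A}))
        size_enum_ord.
  have rows0 : 0 < size rows by rewrite size_rows; lia.
  exists (code_rows cols rows); split.
    rewrite (size_code_rows cols_enum) size_rows card_sum card_prod card_ord /B.
    apply: leq_mul; first by rewrite !leq_add.
    by rewrite leq_add2r leq_double leq_add2l leq_mul.
  move=> x; apply: iff_trans (xP x); rewrite -certificate_rowsP; split.
    move=> [w [_]]; rewrite check_langP => ck.
    have := check_code_rows_size rows0 ck.
    rewrite size_cols size_cat size_tuple => /addnI sw.
    exists (fun p => nth false w (index p (enum {: N * A}))).
    rewrite -(check_code_rows cols_enum) map_col_value.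
    suff -> : [seq nth false w (index p (enum {: N * A})) | p <- enum {: N * A}] =
        w by [].
    apply: (@eq_from_nth _ false); rewrite (size_map _ (enum _)) ?sw // => i ilt.
    have [p0 _] : exists p0 : N * A, true by case: (enum _) ilt => // p0; exists p0.
    by rewrite (nth_map p0) //= index_uniq ?enum_uniq.
  move=> [Z okZ].
  exists [seq Z p | p <- enum {: N * A}]; split.
    (* There is at least one row, and it has a column for every bit of the witness; so the witness
       is shorter than the input. *)
    rewrite (size_map _ (enum {: N * A})) -cardE /poly_bound expn1.
    rewrite size_pair_code (size_code_rows cols_enum) card_sum.
    by move: (size rows) rows0 (#|{: N * A}|) => m m0 k; nia.
  rewrite check_langP.
  have := check_code_rows cols_enum (col_value x Z) rows.
  by rewrite okZ map_col_value => ->.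
exists (fun z => ~ cert z), (fun n => sval (adv n)), c; split.
- exists check_lang, 1; split; first exact: check_lang_in_P.
  by move=> z; split=> [/NNPP | H1 H2].
- by move=> n; case: (adv n) => a [/= le_a _]; apply: leq_trans le_a (cP n).
- move=> x; case: (adv (size x)) => a [/= _ /(_ (in_tuple x)) /= ->].
  by split=> [Lx | /NNPP].
Qed.

(** * Tableaux of Turing machines *)

Lemma expr_eq (N A : finType) (V : eqType) n (h : A -> V) v :
  expressible 1 (fun s : N -> A => h (s n) = v).
Proof.
by apply: expr_ext (expr_lit n (fun a => h a == v)) => s; split=> /eqP.
Qed.

Lemma expr_forall_ord (N A : finType) m r (P : 'I_m -> (N -> A) -> Prop) :
  (forall i, expressible r (P i)) -> expressible (m * r) (fun s => forall i, P i s).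
Proof. by move=> /expr_forall; rewrite card_ord. Qed.

Lemma expr_if (N A : finType) r (b : bool) (P : (N -> A) -> Prop) :
  expressible r P -> expressible r (fun s => b -> P s).
Proof.
case: b => PE; first by apply: expr_ext PE => s; split=> H //; apply: H.
by apply: expr_le (leq0n r); apply: expr_ext (expr_true N A).
Qed.

(* Head-relative contents of a tape: the head scans position [B]. *)
Definition get (S : finType) (B : nat) (t : tape S) (j : nat) : cell S :=
  if j < B then nth None t.1 (B.-1 - j) else nth None t.2 (j - B).

(** The head stays at [B] and the tape slides under it: cell [j] after the move was cell
    [shift mv j] before. Hence no node has to record a head position. *)
Definition shift (mv : move) (j : nat) : nat :=
  match mv with Left => j.-1 | Stay => j | Right => j.+1 end.

Lemma get_act (S : finType) B (t : tape S) (am : cell S * move) j : 0 < j -> 0 < B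
    ->
  get B (act t am) j =
  if shift am.2 j == B then am.1 else get B t (shift am.2 j).
Proof.
case: t am => l r [a mv] j0 B0; rewrite /get /act; case: mv => /=.
- case: (ltngtP j B) => jB.
  + have -> : (j.-1 == B) = false by lia.
    have -> : j.-1 < B by lia.
    by rewrite nth_behead; congr nth; lia.
  + have -> : (j.-1 == B) = (j == B.+1) by lia.
    case: eqP => [-> | jB'].
      by have -> : B.+1 - B = 1 by lia.
    have -> : (j.-1 < B) = false by lia.
    have -> : j - B = (j.-1 - B.+1).+2 by lia.
    by rewrite /= nth_behead; congr nth; lia.
  + have -> : (j.-1 == B) = false by lia.
    have -> : j.-1 < B by lia.
    have -> : j - B = 0 by lia.
    have -> : B.-1 - j.-1 = 0 by lia.
    by rewrite /= nth0.
- case: (ltngtP j B) => jB //.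
    have -> : j - B = (j - B).-1.+1 by lia.
    by rewrite /= nth_behead.
  by have -> : j - B = 0 by lia.
- case: (ltngtP j B) => jB.
  + have -> : (j.+1 == B) = (B.-1 - j == 0) by lia.
    case: eqP => [-> | jB'] //.
    have -> : j.+1 < B by lia.
    have -> : B.-1 - j = (B.-1 - j.+1).+1 by lia.
    by [].
  + have -> : (j.+1 == B) = false by lia.
    have -> : (j.+1 < B) = false by lia.
    by rewrite nth_behead; congr nth; lia.
  + have -> : (j.+1 == B) = false by lia.
    have -> : (j.+1 < B) = false by lia.
    by rewrite nth_behead; congr nth; lia.
Qed.

Lemma get_scanned (S : finType) B (t : tape S) : get B t B = scanned t.
Proof. by rewrite /get ltnn subnn nth0. Qed.

Definition run (M : TM) (u : seq bool) (i : nat) : config M :=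
  iter i (@step M) (init M u).

Lemma act_size (S : finType) (t : tape S) am :
  size (act t am).1 <= (size t.1).+1 /\ size (act t am).2 <= (maxn 1 (size t.2)).+1.
Proof.
by case: t am => l r [a [||]] /=; rewrite ?size_behead; lia.
Qed.

Lemma run_size (M : TM) u i k :
  size ((run M u i).2 k).1 <= i /\ size ((run M u i).2 k).2 <= (size u).+1 + i.
Proof.
elim: i => [|i [IH1 IH2]].
  by rewrite ffunE /=; case: (k == ord0); rewrite ?size_map addn0.
rewrite /run iterS -/(run M u i) /step.
case: (tm_halt _); first by lia.
by rewrite ffunE; have := act_size ((run M u i).2 k) ((tm_trans (run M u i).1 [ffun
    i0 => scanned ((run M u i).2 i0)]).2 k); lia.
Qed.

Section Tableau.
Variables (M : TM) (T B : nat) (X E : finType).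
Local Notation tapes := 'I_(tm_work M).+1.
Local Notation pos := 'I_(B.*2).+1.
Local Notation sym := (cell (tm_sym M)).

(* [inr (i, None)] carries the state at time [i], [inr (i, Some (k, j))] the
   cell of tape [k] at head-relative position [j]. *)
Definition tab_node : finType := (X + 'I_T.+1 * option (tapes * pos))%type.

(** All nodes share one set of values: cell nodes are read through the first component, state nodes
    through the second, and the extra nodes in [X] through [E]. *)
Definition tab_alt : finType := (sym * tm_state M * E)%type.

Implicit Types s : tab_node -> tab_alt.

Definition cell_at s (i : nat) (k : tapes) (j : nat) : sym :=
  (s (inr (inord i, Some (k, inord j)))).1.1.

Definition state_at s (i : nat) : tm_state M := (s (inr (inord i, None))).1.2.

(** Rewriting the scanned symbols in place makes halting a fixed point, so a tableau of fixed height
    also describes runs that halt early. *)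
Definition delta (q : tm_state M) (c : {ffun tapes -> sym}) :=
  if tm_halt q then (q, [ffun k => (c k, Stay)]) else tm_trans q c.

Definition step_ok s (i : nat) : Prop :=
  let d := delta (state_at s i) [ffun k => cell_at s i k B] in
  state_at s i.+1 = d.1 /\
  forall (k : tapes) (j : pos), 0 < j < B.*2 ->
    cell_at s i.+1 k j =
    if shift (d.2 k).2 j == B then (d.2 k).1
    else cell_at s i k (shift (d.2 k).2 j).

(** The local rule may look past the two ends of the window, so it stops short of them. Blank
    borders are correct when the window exceeds the input length plus [T]. *)
Definition tableau s : Prop :=
  [/\ state_at s 0 = tm_start M,
      forall i : 'I_T, step_ok s i
    & forall (i : 'I_T.+1) (k : tapes),
        cell_at s i k 0 = None /\ cell_at s i k B.*2 = None].

(** The state and the scanned symbols are read by a case split, and copying a cell costs another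
    factor [#|sym|]. The sizes of [X] and [E] do not enter. *)
Definition tableau_rows : nat :=
  1 + (T * (#|tm_state M| * (#|sym| ^ (tm_work M).+1 *
        (1 + (tm_work M).+1 * ((B.*2).+1 * #|sym|))))
  + T.+1 * ((tm_work M).+1 * 2)).

Lemma expr_tableau : expressible tableau_rows tableau.
Proof.
rewrite /tableau_rows.
have E1 : expressible 1 (fun s => state_at s 0 = tm_start M).
  exact: (@expr_eq _ _ _ _ (fun a : tab_alt => a.1.2)).
have E3 : expressible (T.+1 * ((tm_work M).+1 * 2)) (fun s => 
    forall (i : 'I_T.+1) (k : tapes),
        cell_at s i k 0 = None /\ cell_at s i k B.*2 = None).
  apply: expr_forall_ord => i; apply: expr_forall_ord => k.
  by apply: (@expr_and _ _ 1 1); apply: (@expr_eq _ _ _ _ (fun a : tab_alt =>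
      a.1.1)).
suff E2 : expressible (T * (#|tm_state M| * (#|sym| ^ (tm_work M).+1 *
        (1 + (tm_work M).+1 * ((B.*2).+1 * #|sym|)))))
    (fun s => forall i : 'I_T, step_ok s i).
  apply: expr_ext (expr_and E1 (expr_and E2 E3)) => s.
  by split=> [[H1 [H2 H3]] | [H1 H2 H3]].
apply: expr_forall_ord => i.
pose cond q c s := let d := delta q c in
  state_at s i.+1 = d.1 /\
  forall (k : tapes) (j : pos), 0 < j < B.*2 ->
    cell_at s i.+1 k j =
    if shift (d.2 k).2 j == B then (d.2 k).1
    else cell_at s i k (shift (d.2 k).2 j).
apply: (@expr_read _ _ _ _ _ (fun a : tab_alt => a.1.2)
   (fun q s => cond q [ffun k => cell_at s i k B] s)) => q.
rewrite -[X in _ ^ X](card_ord (tm_work M).+1).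
apply: (@expr_reads _ _ _ _ _ _ (fun a : tab_alt => a.1.1) (fun c s => cond q c s))
    => c.
apply: expr_and; first exact: (@expr_eq _ _ _ _ (fun a : tab_alt => a.1.2)).
apply: expr_forall_ord => k; apply: expr_forall_ord => j; apply: expr_if.
rewrite -[#|sym|]muln1.
set d := delta q c.
apply: (@expr_read _ _ _ _ _ (fun a : tab_alt => a.1.1) (fun v s =>
  cell_at s i.+1 k j = if shift (d.2 k).2 j == B then (d.2 k).1 else v)) => v.
exact: (@expr_eq _ _ _ _ (fun a : tab_alt => a.1.1)).
Qed.

Definition starts_with (u : seq bool) s : Prop :=
  forall (k : tapes) (j : pos), cell_at s 0 k j = get B ((init M u).2 k) j.

Lemma step_get u i (k : tapes) j (c := run M u i)
    (d := delta c.1 [ffun k => scanned (c.2 k)]) :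
  0 < j -> 0 < B ->
  (run M u i.+1).1 = d.1 /\
  get B ((run M u i.+1).2 k) j =
  if shift (d.2 k).2 j == B then (d.2 k).1 else get B (c.2 k) (shift (d.2 k).2 j).
Proof.
move=> j0 B0; rewrite /d /delta /run iterS -/(run M u i) -/c /step.
case: (tm_halt c.1); last by rewrite ffunE get_act.
by split=> //; rewrite !ffunE /=; case: eqP => // ->; rewrite get_scanned.
Qed.

Lemma shift_lt (j : pos) mv : 0 < j < B.*2 -> shift mv j < (B.*2).+1.
Proof. by case: mv => /=; lia. Qed.

Lemma run_boundary u i k : size u + T + 2 <= B -> i <= T ->
  get B ((run M u i).2 k) 0 = None /\ get B ((run M u i).2 k) B.*2 = None.
Proof.
move=> uB iT; have [s1 s2] := run_size u i k; rewrite /get.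
have -> : 0 < B by lia.
have -> : (B.*2 < B) = false by lia.
by split; apply: nth_default; move: s1 s2; lia.
Qed.

Lemma tableau_sound u s : size u + T + 2 <= B -> tableau s -> starts_with u s ->
  forall i, i <= T -> state_at s i = (run M u i).1 /\
    forall k (j : pos), cell_at s i k j = get B ((run M u i).2 k) j.
Proof.
move=> uB [s0 sS sB] su; elim=> [_ | i IH lt_iT]; first by rewrite s0.
have [IH1 IH2] := IH (ltnW lt_iT).
have := sS (Ordinal lt_iT); rewrite /step_ok /=.
have Bp : B < (B.*2).+1 by lia.
have -> : [ffun k => cell_at s i k B] = [ffun k => scanned ((run M u i).2 k)].
  by apply/ffunP => k; rewrite !ffunE (IH2 k (Ordinal Bp)) get_scanned.
rewrite IH1 => -[H1 H2]; split.
  by rewrite H1; have [-> _] := @step_get u i ord0 1 isT (ltac:(lia)).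
move=> k j; case jB: (0 < j < B.*2); last first.
  have iT : i.+1 < T.+1 by [].
  have [n0 nB] := sB (Ordinal iT) k.
  have [g0 gB] := run_boundary k uB lt_iT.
  have [-> | ->] : nat_of_ord j = 0 \/ nat_of_ord j = B.*2 by have := ltn_ord j;
      lia.
    by rewrite g0 n0.
  by rewrite gB nB.
have [_ ->] := @step_get u i k j (ltac:(lia)) (ltac:(lia)).
rewrite H2 //; case: eqP => // _.
by have := IH2 k (Ordinal (shift_lt _ jB)); apply.
Qed.

Definition canonical (u : seq bool) (xi : X -> tab_alt) (e : E) : tab_node ->
    tab_alt :=
  fun n => match n with
  | inl x => xi x
  | inr (i, None) => (None, (run M u i).1, e)
  | inr (i, Some (k, j)) => (get B ((run M u i).2 k) j, tm_start M, e)
  end.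

Lemma canonical_state u xi e i : i <= T ->
  state_at (canonical u xi e) i = (run M u i).1.
Proof. by move=> iT; rewrite /state_at /= inordK. Qed.

Lemma canonical_cell u xi e i k j : i <= T -> j <= B.*2 ->
  cell_at (canonical u xi e) i k j = get B ((run M u i).2 k) j.
Proof. by move=> iT jB; rewrite /cell_at /= !inordK. Qed.

Lemma canonical_tableau u xi e : size u + T + 2 <= B ->
  tableau (canonical u xi e) /\ starts_with u (canonical u xi e).
Proof.
move=> uB; split; last by move=> k j; rewrite canonical_cell // -ltnS.
split.
- by rewrite canonical_state.
- move=> i; rewrite /step_ok.
  have iT : i <= T by apply: ltnW.
  have -> : [ffun k => cell_at (canonical u xi e) i k B]
     = [ffun k => scanned ((run M u i).2 k)].
    by apply/ffunP => k; rewrite !ffunE canonical_cell // ?get_scanned //; lia.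
  rewrite !canonical_state //; split.
    by have [-> _] := @step_get u i ord0 1 isT (ltac:(lia)).
  move=> k j jB; rewrite canonical_cell //; last by lia.
  have [_ ->] := @step_get u i k j (ltac:(lia)) (ltac:(lia)).
  by case: eqP => // _; rewrite canonical_cell // -ltnS shift_lt.
- move=> i k; have iT : i <= T by rewrite -ltnS.
  have [g0 gB] := run_boundary k uB iT.
  by rewrite !canonical_cell.
Qed.

(** The input word may itself be read off nodes of [s]; [r] is the price of one of its cells. *)
Lemma expr_starts_with r (u : (tab_node -> tab_alt) -> seq bool) :
  0 < r ->
  (forall p, p <= B -> expressible r (fun s =>
     cell_at s 0 ord0 (B + p) = nth None [seq Some (inl b) | b <- u s] p)) ->
  expressible ((tm_work M).+1 * ((B.*2).+1 * r)) (fun s => starts_with (u s) s).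
Proof.
move=> r0 uE; apply: expr_forall_ord => k; apply: expr_forall_ord => j.
case: (boolP ((k == ord0) && (B <= j))) => [/andP[/eqP -> Bj] | nj].
  have jB : j - B <= B by have := ltn_ord j; lia.
  apply: expr_ext (uE _ jB) => s.
  by rewrite subnKC // ffunE /get ltnNge Bj.
apply: (expr_le _ r0).
apply: (expr_ext _ (@expr_eq _ _ _ (inr (inord 0, Some (k, inord j)))
   (fun a : tab_alt => a.1.1) None)) => s.
suff -> : get B ((init M (u s)).2 k) j = None by [].
rewrite ffunE /get; case: ltnP => jB; rewrite ?nth_nil //=.
by case: (k == ord0) nj; rewrite ?nth_nil //= jB.
Qed.

End Tableau.

(** * Selecting one of several inputs *)

Lemma nth_pair_code (S : finType) x w p :
  nth None [seq Some (inl b) : cell S | b <- pair_code x w] p =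
  if p < (size x).*2 then Some (inl (if odd p then nth false x p./2 else true))
  else if p == (size x).*2 then Some (inl false)
  else nth None [seq Some (inl b) | b <- w] (p - (size x).*2.+1).
Proof.
elim: x p => [|b x IH] [|[|p]] //=; rewrite -/(pair_code x w) IH /=.
by rewrite negbK !ltnS doubleS !eqSS !subSS.
Qed.

(** Acceptance is visible in two cells, hence costs two clauses. *)
Lemma leading_bits_true (S : finType) (r : seq (cell S)) :
  leading_bits r = [:: true] <->
  nth None r 0 = Some (inl true) /\ unbit (nth None r 1) = None.
Proof.
case: r => [|[[b|?]|] r] /=; try by split=> // -[].
case: r => [|[[b'|?]|] r] /=; split=> //; try by case=> -> // [].
all: try by case=> ->.
all: try by case=> [[->]].
Qed.

(* A bit of a string in which each position is a constant or, up to negation,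
   one bit of one of the words [Y i]. *)
Definition token (t n : nat) := (option ('I_t * 'I_n) * bool)%type.

Definition fill t n (Y : {ffun 'I_t -> n.-tuple bool}) (k : token t n) : bool :=
  oapp (fun p => tnth (Y p.1) p.2) false k.1 (+) k.2.

Definition token_valued t n (g : {ffun 'I_t -> n.-tuple bool} -> bool) : Prop :=
  exists k : token t n, forall Y, g Y = fill Y k.

Lemma token_const t n b : @token_valued t n (fun=> b).
Proof. by exists (None, b). Qed.

Lemma run_within (M : TM) u T k y :
  computes_within M u k y -> k <= T -> tm_halt (run M u T).1 /\ output (run M u T)
      = y.
Proof.
move=> [h o] kT; rewrite /run -(subnK kT) iterD.
by rewrite iter_halt.
Qed.

Section Gadget.
Variables (M : TM) (n t q T : nat).

(** This is [size u + T + 2] for an input [u] of the maximal length [n.*2 + q + 1]. *)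
Let B := n.*2 + q + T + 3.
Let X : finType := option ('I_n + 'I_q).
Let E : finType := ('I_t.+1 * 'I_q.+1 * bool)%type.
Let node := tab_node M T B X.
Let alt := tab_alt M E.

Implicit Type s : node -> alt.

Let xbit s (j : 'I_n) := (s (inl (Some (inl j)))).2.2.
Let wbit s (p : 'I_q) := (s (inl (Some (inr p)))).2.2.
Let wlen s : 'I_q.+1 := (s (inl None)).2.1.2.
Let sel s : 'I_t.+1 := (s (inl None)).2.1.1.

Definition gadget_input s : seq bool :=
  pair_code [seq xbit s j | j <- enum 'I_n] (take (wlen s) [seq wbit s p | p <-
      enum 'I_q]).

Definition gadget_rows : nat :=
  tableau_rows M T B + ((tm_work M).+1 * ((B.*2).+1 * (q.+1 * 2)) + 2).

Lemma size_bits_enum (m : nat) (f : 'I_m -> bool) : size [seq f j | j <- enum 'I_m]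
    = m.
Proof. by rewrite (size_map f (enum 'I_m)) size_enum_ord. Qed.

Lemma nth_bits_enum (m : nat) (f : 'I_m -> bool) (j : 'I_m) :
  nth false [seq f j | j <- enum 'I_m] j = f j.
Proof. by rewrite (nth_map j) ?size_enum_ord // nth_ord_enum. Qed.

Lemma expr_gadget : expressible gadget_rows (fun s =>
  [/\ tableau s, starts_with (gadget_input s) s,
      cell_at s T ord0 B = Some (inl true) & unbit (cell_at s T ord0 B.+1) = None]).
Proof.
have E2 : expressible ((tm_work M).+1 * ((B.*2).+1 * (q.+1 * 2)))
    (fun s => starts_with (gadget_input s) s).
  apply: expr_starts_with => // p pB.
  have E1 c : expressible 1 (fun s => cell_at s 0 ord0 (B + p) = c).
    exact: (@expr_eq _ _ _ _ (fun a : alt => a.1.1)).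
  case: (ltnP p n.*2) => [pn | np].
    have jn : p./2 < n by lia.
    case op : (odd p); last first.
      apply: (@expr_le _ _ 1) => //; apply: expr_ext (E1 (Some (inl true))) => s.
      by rewrite /gadget_input nth_pair_code size_bits_enum pn op.
    apply: (@expr_le _ _ (#|{: bool}| * 1)); last by rewrite muln1 card_bool mulSn
        leq_addr.
    apply: (@expr_ext _ _ _ (fun s => cell_at s 0 ord0 (B + p) = Some (inl (xbit s
        (Ordinal jn))))).
      move=> s; rewrite /gadget_input nth_pair_code size_bits_enum pn op.
      by rewrite -(nth_bits_enum (xbit s) (Ordinal jn)).
    apply: (@expr_read _ _ _ _ _ (fun a : alt => a.2.2)
      (fun b s => cell_at s 0 ord0 (B + p) = Some (inl b))) => b.
    exact: (@expr_eq _ _ _ _ (fun a : alt => a.1.1)).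
  case: (eqVneq p n.*2) => [Ep | nep].
    apply: (@expr_le _ _ 1) => //; apply: expr_ext (E1 (Some (inl false))) => s.
    by rewrite /gadget_input nth_pair_code size_bits_enum Ep ltnn eqxx.
  set p' := p - n.*2.+1.
  apply: (@expr_ext _ _ _ (fun s => cell_at s 0 ord0 (B + p) =
     nth None [seq Some (inl b) | b <- take (wlen s) [seq wbit s p | p <- enum
         'I_q]] p')).
    move=> s; rewrite /gadget_input nth_pair_code size_bits_enum.
    by rewrite ltnNge np (negbTE nep).
  rewrite -{1}(card_ord q.+1).
  apply: (@expr_read _ _ _ _ _ (fun a : alt => a.2.1.2)
    (fun (l : 'I_q.+1) s => cell_at s 0 ord0 (B + p) =
     nth None [seq Some (inl b) | b <- take l [seq wbit s p | p <- enum 'I_q]] p'))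
         => l.
  case: (ltnP p' l) => [pl | lp].
    have pq : p' < q by have := ltn_ord l; lia.
    rewrite -card_bool -[#|_|]muln1.
    apply: (@expr_ext _ _ _ (fun s => cell_at s 0 ord0 (B + p) = Some (inl (wbit s
        (Ordinal pq))))).
      move=> s; rewrite (nth_map false); last first.
        by rewrite size_takel ?size_bits_enum // -ltnS.
      by rewrite nth_take // -(nth_bits_enum (wbit s) (Ordinal pq)).
    apply: (@expr_read _ _ _ _ _ (fun a : alt => a.2.2)
      (fun b s => cell_at s 0 ord0 (B + p) = Some (inl b))) => b.
    exact: (@expr_eq _ _ _ _ (fun a : alt => a.1.1)).
  apply: (@expr_le _ _ 1) => //.
  apply: expr_ext (E1 None) => s.
  suff -> : nth None [seq Some (inl b) | b <- take l [seq wbit s p | p <- enum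
      'I_q]] p' = None :> cell (tm_sym M) by [].
  by apply: nth_default; rewrite (size_map _ (take _ _)) size_take_min geq_min lp.
have E3 : expressible 2 (fun s =>
    cell_at s T ord0 B = Some (inl true) /\ unbit (cell_at s T ord0 B.+1) = None).
  apply: (@expr_and _ _ 1 1); first exact: (@expr_eq _ _ _ _ (fun a : alt =>
      a.1.1)).
  exact: (@expr_eq _ _ _ _ (fun a : alt => unbit a.1.1)).
apply: expr_ext (expr_and (@expr_tableau M T B X E) (expr_and E2 E3)) => s.
by split=> [[? [? []]] | []].
Qed.

Lemma size_gadget_input s : size (gadget_input s) <= n.*2 + q + 1.
Proof.
rewrite size_pair_code size_bits_enum size_take_min size_bits_enum; lia.
Qed.

(** The last condition, tying the bit nodes to the selected word, is kept out of [expr_gadget]: it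
    is the only one that mentions the words. *)
Lemma gadgetP (L : language) (V : seq bool -> Prop) (x : 'I_t.+1 -> n.-tuple bool) :
  (forall i, L (x i) <-> exists w, size w <= q /\ V (pair_code (x i) w)) ->
  (forall u, size u <= n.*2 + q + 1 -> V u <-> output (run M u T) = [:: true]) ->
  (exists s : node -> alt, [/\ tableau s, starts_with (gadget_input s) s,
      cell_at s T ord0 B = Some (inl true), unbit (cell_at s T ord0 B.+1) = None
    & forall j, xbit s j = tnth (x (sel s)) j])
  <-> exists i, L (x i).
Proof.
move=> xL Vrun; have B1 : B.+1 < (B.*2).+1 by rewrite /B; lia.
have outE u : output (run M u T) = [:: true] <->
    get B ((run M u T).2 ord0) B = Some (inl true) /\
    unbit (get B ((run M u T).2 ord0) B.+1) = None.
  rewrite /output leading_bits_true /get ltnn subnn.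
  have -> : B.+1 < B = false by lia.
  by rewrite subSnn.
split=> [[s [ts us a1 a2 sx]] | [i]].
  exists (sel s); apply/xL.
  have su : size (gadget_input s) + T + 2 <= B.
    by have := size_gadget_input s; rewrite /B; lia.
  have [_ cells] := tableau_sound su ts us (leqnn T).
  exists (take (wlen s) [seq wbit s p | p <- enum 'I_q]); split.
    by rewrite size_take_min size_bits_enum geq_minr.
  have Ex : [seq xbit s j | j <- enum 'I_n] = x (sel s).
    by rewrite -[RHS]map_tnth_enum; apply: eq_map.
  rewrite -Ex; apply/(Vrun _ (size_gadget_input s))/outE.
  by rewrite -(cells ord0 (Ordinal (ltnW B1))) -(cells ord0 (Ordinal B1)).
move=> /xL[w [wq Vw]].
pose e0 : E := (i, inord (size w), false).
pose xi (y : X) : alt := (None, tm_start M,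
  match y with
  | None => e0
  | Some (inl j) => (e0.1, tnth (x i) j)
  | Some (inr p) => (e0.1, nth false w p)
  end).
pose s : node -> alt := canonical (pair_code (x i) w) xi e0.
have Eu : gadget_input s = pair_code (x i) w.
  rewrite /gadget_input; congr pair_code.
    by rewrite -[RHS]map_tnth_enum; apply: eq_map.
  rewrite /wlen /= inordK //.
  apply: (@eq_from_nth _ false); rewrite size_takel ?size_bits_enum // => p pw.
  rewrite nth_take //; have pq : p < q by apply: leq_trans wq.
  by rewrite (nth_bits_enum (wbit s) (Ordinal pq)).
have su := size_gadget_input s; rewrite Eu in su.
have suT : size (pair_code (x i) w) + T + 2 <= B by rewrite /B; lia.
have [ts us] := canonical_tableau xi e0 suT.
have [a1 a2] := (outE _).1 ((Vrun _ su).1 Vw).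
exists s; split=> //; first by rewrite Eu.
- by rewrite canonical_cell //; lia.
- by rewrite canonical_cell //; lia.
Qed.

End Gadget.

Lemma np_gadget (L : language) : in_NP L ->
  exists2 kappa, pbounded kappa & forall n t,
  exists (N A R : finType)
         (lit : {ffun 'I_t.+1 -> n.-tuple bool} -> R -> N -> A -> bool),
  [/\ [/\ 0 < #|N|, 0 < #|A|, #|N| <= kappa n, #|R| <= kappa n
        & #|A| <= kappa n * t.+1],
      forall r m a, token_valued (fun Y => lit Y r m a)
    & forall Y, (exists s, forall r, exists m, lit Y r m (s m)) <-> exists i, L (Y
        i)].
Proof.
move=> [V [c0 [[f [[M [c1 Mf]] Vf]] LV]]].
pose q n := poly_bound c0 n.
pose T n := poly_bound c1 (n.*2 + q n + 1).
pose B n := n.*2 + q n + T n + 3.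
pose kN n := (n + q n).+1 + (T n).+1 * ((tm_work M).+1 * ((B n).*2).+1).+1.
pose kR n := gadget_rows M n (q n) (T n) + n * 2.
pose kA n := #|{: cell (tm_sym M)}| * #|tm_state M| * ((q n).+1 * 2).
exists (fun n => kN n + kR n + kA n).
  rewrite /kN /kR /kA /gadget_rows /tableau_rows /B /T /q; pb.
move=> n t.
have [phi le_phi phiP] := @expr_gadget M n t (q n) (T n).
pose X : finType := option ('I_n + 'I_(q n)).
pose E : finType := ('I_t.+1 * 'I_(q n).+1 * bool)%type.
pose N := tab_node M (T n) (B n) X.
pose A := tab_alt M E.
(* Clause [(j, b)] says that if bit node [j] carries [b], so does the word chosen by the selector
   [inl None]; both values of [b] together give equality. Their number does not depend on [t]. *)
pose lit (Y : {ffun 'I_t.+1 -> n.-tuple bool}) (r : 'I_(size phi) + 'I_n * bool)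
    (m : N) (a : A) : bool :=
  match r with
  | inl i => nth (fun _ _ => false) phi i m a
  | inr (j, b) =>
    match m with
    | inl None => tnth (Y a.2.1.1) j == b
    | inl (Some (inl j')) => (j' == j) && (a.2.2 != b)
    | _ => false
    end
  end.
exists N, A, ('I_(size phi) + 'I_n * bool)%type, lit; split.
- split.
  + by apply/card_gt0P; exists (inl None).
  + by apply/card_gt0P; exists (None, tm_start M, (ord0, ord0, false)).
  + rewrite card_sum card_prod !card_option card_sum card_prod !card_ord.
    by rewrite /kN; lia.
  + rewrite card_sum card_prod card_bool !card_ord /kR.
    by move: le_phi; rewrite -/(B n); lia.
  + rewrite !card_prod !card_ord card_bool.
    apply: (@leq_trans (kA n * t.+1)); last by rewrite leq_mul2r; lia.
    by rewrite /kA; lia.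
- move=> [i | [j b]] m a; first exact: token_const.
  rewrite /token_valued /lit; case: m => [[[j'|p]|]|m]; try exact: token_const.
  exists (Some (a.2.1.1, j), ~~ b) => Y; rewrite /fill /=.
  by case: (tnth _ _); case: b.
- move=> Y.
  have xL i : L (Y i) <-> exists w, size w <= q n /\ V (pair_code (Y i) w).
    by rewrite LV size_tuple.
  have Vrun u : size u <= n.*2 + q n + 1 -> V u <-> output (run M u (T n)) = [::
      true].
    move=> su; rewrite Vf.
    by have [_ ->] := run_within (Mf u) (leq_poly_bound c1 su).
  rewrite -(gadgetP xL Vrun).
  have litP (s : N -> A) : (forall r, exists m, lit Y r m (s m)) <->
     all (csat s) phi /\ forall j, (s (inl (Some (inl j)))).2.2 =
        tnth (Y (s (inl None)).2.1.1) j.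
    split=> [H | [/all_nthP H1 H2] [i | [j b]]].
    + split=> [|j].
        apply/(all_nthP (fun _ _ => false)) => i lt_i.
        by have [m lm] := H (inl (Ordinal lt_i)); apply/existsP; exists m.
      have [[[[j'|p]|]|m]] := H (inr (j, (s (inl (Some (inl j)))).2.2)) => //=.
        by move=> /andP[/eqP ->]; rewrite eqxx.
      by move=> /eqP.
    + by have /existsP := H1 (fun _ _ => false) i (ltn_ord i).
    + have := H2 j; case: (eqVneq (s (inl (Some (inl j)))).2.2 b) => [-> | ne] Eb.
        by exists (inl None); rewrite /= -Eb.
      by exists (inl (Some (inl j))); rewrite /= eqxx.
  split=> [[s /litP[/phiP[H1 H2 H3 H4] H5]] | [s [H1 H2 H3 H4 H5]]]; exists s.
    by split.
  by apply/litP; split=> //; apply/phiP.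
Qed.

(** * From formulas to connected vertex cover *)

Lemma connect_ind (T : finType) (e : rel T) (P : T -> Prop) x y :
  P x -> (forall u v, P u -> e u v -> P v) -> connect e x y -> P y.
Proof.
move=> Px Pe /connectP[p + ->]; elim: p x Px => //= z p IH x Px /andP[/(Pe _ _ Px)
    Pz].
exact: IH.
Qed.

Lemma cvc_imset (T T' : finType) (G : sgraph T) (H : sgraph T') (f : T -> T') (g :
    T' -> T) A :
  cancel f g -> cancel g f -> (forall x y, H (f x) (f y) = G x y) ->
  connected_vertex_cover G A -> connected_vertex_cover H (f @: A).
Proof.
move=> fK gK HG [cov con]; have f_inj := can_inj fK; split.
  move=> x y; rewrite -[x]gK -[y]gK HG => /cov.
  by rewrite !mem_imset.
move=> _ _ /imsetP[x xA ->] /imsetP[y yA ->].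
apply: (@connect_ind _ _ (fun z => connect [rel u v in f @: A | H u v] (f x) (f
    z))) (con x y xA yA) => // u v xu /= /andP[/andP[uA vA] uv].
apply: connect_trans xu (connect1 _).
by rewrite /= !mem_imset // uA vA HG.
Qed.

Section Graph.
Variables (N A R : finType) (lit : R -> N -> A -> bool).

(* Hubs, then the rows of a set cover instance. *)
Definition core : finType := (bool + (N + R))%type.

(* A set for each value of each node, and a dummy set for each clause: the
   dummies only serve to write down a cover of the old graph. *)
Definition chooser : finType := (N * A + R)%type.

Definition vertex : finType := (core + core + chooser)%type.

Lemma card_core : #|core| = 2 + (#|N| + #|R|).
Proof. by rewrite card_sum card_bool card_sum. Qed.

Lemma card_vertex : #|vertex| = #|core| + #|core| + (#|N| * #|A| + #|R|).
Proof. by rewrite !card_sum card_prod. Qed.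

Notation corev c := (inl (inl c) : vertex).
Notation leafv c := (inl (inr c) : vertex).
Notation setv s := (inr s : vertex).

(** A dummy covers the hubs and its own clause, but no node row. *)
Definition covers (c : core) (s : chooser) : bool :=
  match c, s with
  | inl _, _ => true
  | inr (inl m), inl (m', _) => m' == m
  | inr (inl _), inr _ => false
  | inr (inr r), inl (m, a) => lit r m a
  | inr (inr r), inr r' => r' == r
  end.

(** Every core vertex has a pendant leaf, which forces it into connected covers; [hub] switches the
    edge that is added. *)
Definition arc (hub : bool) (x y : vertex) : bool :=
  match x, y with
  | inl (inl c), inl (inr c') => c == c'
  | inl (inl c), inr s => covers c s
  | inl (inl (inl b)), inl (inl (inl b')) => hub && (b != b')
  | _, _ => false
  end.

Definition edge hub (x y : vertex) : bool := arc hub x y || arc hub y x.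

Lemma edge_sym hub : symmetric (edge hub).
Proof. by move=> x y; rewrite /edge orbC. Qed.

Lemma edge_irr hub : irreflexive (edge hub).
Proof. by case=> [[[b|c]|c]|s]; rewrite /edge //= eqxx andbF. Qed.

Definition vgraph hub : sgraph vertex := SGraph (@edge_sym hub) (@edge_irr hub).

Definition ord_edge hub : rel 'I_#|vertex| :=
  fun i j => edge hub (enum_val i) (enum_val j).

Lemma ord_edge_sym hub : symmetric (ord_edge hub).
Proof. by move=> x y; apply: edge_sym. Qed.

Lemma ord_edge_irr hub : irreflexive (ord_edge hub).
Proof. by move=> x; apply: edge_irr. Qed.

Definition ograph hub : sgraph 'I_#|vertex| :=
  SGraph (@ord_edge_sym hub) (@ord_edge_irr hub).

Lemma cvc_ograph hub B :
  connected_vertex_cover (vgraph hub) B ->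
  connected_vertex_cover (ograph hub) (enum_rank @: B).
Proof.
apply: (cvc_imset (g := enum_val)); [exact: enum_rankK | exact: enum_valK |].
by move=> x y; rewrite /= /ord_edge !enum_rankK.
Qed.

Lemma CVC_ograph hub k : CVC (ograph hub) k <-> CVC (vgraph hub) k.
Proof.
split=> -[B [BG leB]].
  exists (enum_val @: B); split; last by rewrite card_imset //; apply: enum_val_inj.
  by apply: cvc_imset BG => //; [exact: enum_valK | exact: enum_rankK].
exists (enum_rank @: B); split; last by rewrite card_imset //; apply: enum_rank_inj.
exact: cvc_ograph.
Qed.

Definition cover_of (Z : {set chooser}) : {set vertex} :=
  [set corev c | c : core] :|: [set setv s | s in Z].

Lemma mem_cover_of Z v : (v \in cover_of Z) =
  match v with inl (inl _) => true | inl (inr _) => false | inr s => s \in Z end.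
Proof.
rewrite inE; case: v => [[c|c]|s].
- by rewrite imset_f.
- by apply/orP => -[] /imsetP[].
- rewrite [X in _ || X]mem_imset; last by move=> ? ? [].
  by rewrite orb_idl // => /imsetP[].
Qed.

Lemma card_cover_of Z : #|cover_of Z| = #|core| + #|Z|.
Proof.
rewrite cardsU !card_imset; try by move=> ? ? [].
suff -> : [set corev c | c : core] :&: [set setv s | s in Z] = set0 by rewrite
    cards0 subn0.
apply/setP => v; rewrite !inE; apply/andP => -[/imsetP[c _ ->] /imsetP[]] //.
Qed.

Lemma edge_leaf hub c d : edge hub (corev c) (leafv d) = (c == d).
Proof. by case: c => [b|c]; rewrite /edge /= orbF. Qed.

Lemma edge_set hub c z : edge hub (corev c) (setv z) = covers c z.
Proof. by case: c => [b|c]; rewrite /edge /= ?orbF. Qed.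

(** Each chosen set is adjacent to the hubs and each core vertex to a chosen set, so everything is
    within two steps of a hub. *)
Lemma cover_of_cvc hub (Z : {set chooser}) :
  (forall c, exists2 s, s \in Z & covers c s) ->
  connected_vertex_cover (vgraph hub) (cover_of Z).
Proof.
move=> hit; split.
  move=> x y; rewrite /= !mem_cover_of.
  by case: x y => [[c|c]|s] [[c'|c']|s']; rewrite /edge /= ?orbT.
pose e := [rel u v in cover_of Z | vgraph hub u v].
have e_sym : connect_sym e.
  by apply: sym_connect_sym => x y; rewrite /e /= edge_sym; congr (_ && _); rewrite
      andbC.
have to_hub x : x \in cover_of Z -> connect e (corev (inl true)) x.
  have hubs s : s \in Z -> connect e (corev (inl true)) (setv s).
    by move=> sZ; apply: connect1; rewrite /e /= !mem_cover_of sZ edge_set.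
  rewrite mem_cover_of; case: x => [[c|c]|s] //; last exact: hubs.
  move=> _; have [s sZ cs] := hit c; apply: connect_trans (hubs s sZ) _; rewrite
      e_sym.
  by apply: connect1; rewrite /e /= !mem_cover_of sZ edge_set.
move=> x y xA yA; apply: connect_trans (to_hub y yA).
by rewrite e_sym to_hub.
Qed.

(** Without [c] the cover contains its leaf, which is then isolated in [B], while the leaf edge at
    another core vertex [c'] puts a second vertex into [B]. *)
Lemma cvc_core B c : connected_vertex_cover (vgraph true) B -> corev c \in B.
Proof.
move=> [cov con]; apply/idP/negPn/negP => cB.
have leafB : leafv c \in B.
  have := cov (corev c) (leafv c); rewrite (negbTE cB) /= edge_leaf eqxx.
  by apply.
pose c' : core := if c is inl b then inl (~~ b) else inl true.
have nc : c' != c by rewrite /c'; case: (c) => // -[].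
have [y yB yc] : exists2 y, y \in B & (y == corev c') || (y == leafv c').
  have /orP[] : (corev c' \in B) || (leafv c' \in B).
    by apply: cov; rewrite /= edge_leaf eqxx.
  - by exists (corev c'); rewrite ?eqxx.
  - by exists (leafv c'); rewrite ?eqxx ?orbT.
have : y = leafv c.
  apply: (@connect_ind _ _ (fun v => v = leafv c)) (con _ _ leafB yB) => //.
  move=> u v -> /= /andP[/andP[_ vB]]; rewrite edge_sym.
  by case: v vB => [[d|d]|s] // dB; rewrite edge_leaf => /eqP dc; rewrite -dc dB in
      cB.
by move: yc nc => + + Ey; rewrite Ey => /orP[] /eqP // [->]; rewrite eqxx.
Qed.

(** Apart from its leaf, a row has only sets as neighbours; with none of these in [B], no hub could
    be reached from the row. *)
Lemma cvc_hit B (r : N + R) : connected_vertex_cover (vgraph true) B ->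
  exists2 s, setv s \in B & covers (inr r) s.
Proof.
move=> Bcvc; have [_ con] := Bcvc.
have cB := cvc_core (inr r) Bcvc; have hB := cvc_core (inl true) Bcvc.
case: (pickP [pred s | (setv s \in B) && covers (inr r) s]) => [s /andP[] | none].
  by exists s.
have : corev (inl true) = corev (inr r) \/ corev (inl true) = leafv (inr r); last
    by case.
apply: (@connect_ind _ _ (fun v => v = corev (inr r) \/ v = leafv (inr r)))
   (con _ _ cB hB); first by left.
move=> u v [] -> /= /andP[/andP[_ vB]].
  case: v vB => [[[b|d]|d]|s] vB //; first by rewrite edge_leaf => /eqP <-; right.
  by rewrite edge_set => cs; case/negP: (negbT (none s)); apply/andP.
rewrite edge_sym; case: v vB => [[d|d]|s] vB //.
by rewrite edge_leaf => /eqP ->; left.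
Qed.

(** The core is forced, which leaves [#|N|] sets. Every node row needs a set of its own, so these
    are one value per node and no dummy. *)
Lemma CVC_vgraph : 0 < #|N| ->
  CVC (vgraph true) (#|core| + #|N|) <->
  exists s : N -> A, forall r, exists m, lit r m (s m).
Proof.
move=> N0; split=> [[B [Bcvc leB]] | [s sP]].
  pose Z := [set s : chooser | setv s \in B].
  have leZ : #|Z| <= #|N|.
    rewrite -(leq_add2l #|core|) -card_cover_of; apply: leq_trans leB.
    apply/subset_leq_card/subsetP => v; rewrite mem_cover_of.
    case: v => [[c|c]|z] //; last by rewrite inE.
    by rewrite cvc_core.
  have /fin_all_exists[s sZ] : forall m, exists a, inl (m, a) \in Z.
    move=> m; have [[[m' a]|r'] zB] := cvc_hit (inl m) Bcvc; last by [].
    by move=> /= /eqP Em; exists a; rewrite inE -Em.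
  have Zs : [set (inl (m, s m) : chooser) | m : N] = Z.
    apply/eqP; rewrite eqEcard; apply/andP; split.
      by apply/subsetP => _ /imsetP[m _ ->].
    by rewrite card_imset // => ? ? [].
  exists s => r; have [z zB zr] := cvc_hit (inr r) Bcvc.
  have : z \in Z by rewrite inE.
  by rewrite -Zs => /imsetP[m _ Ez]; exists m; rewrite Ez in zr.
pose Z := [set (inl (m, s m) : chooser) | m : N].
exists (cover_of Z); split; last first.
  by rewrite card_cover_of leq_add2l leq_imset_card.
have inZ m : inl (m, s m) \in Z by apply: imset_f.
have [m0 _] := card_gt0P N0.
apply: cover_of_cvc => -[b | [m | r]].
- by exists (inl (m0, s m0)).
- by exists (inl (m, s m)) => //=.
- by have [m lm] := sP r; exists (inl (m, s m)).
Qed.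

(** No literal is consulted, so the old solution and its code are the same for all input words. *)
Definition old_choice (a0 : A) : {set chooser} :=
  [set inl (m, a0) | m : N] :|: [set inr r | r : R].

Lemma old_choice_hit a0 c : 0 < #|N| -> exists2 s, s \in old_choice a0 & covers c s.
Proof.
move=> /card_gt0P[m0 _].
have inN m : inl (m, a0) \in old_choice a0 by rewrite inE imset_f.
case: c => [b | [m | r]].
- by exists (inl (m0, a0)).
- by exists (inl (m, a0)) => //=.
- by exists (inr r) => //=; rewrite inE imset_f ?orbT.
Qed.

Lemma card_old_choice a0 : #|old_choice a0| <= #|N| + #|R|.
Proof. by rewrite (leq_trans (leq_card_setU _ _)) // leq_add ?leq_imset_card. Qed.

Lemma hub_edge_addition : is_edge_addition (ograph false) (ograph true).
Proof.
pose h b : vertex := corev (inl b).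
have hE i b : (i == enum_rank (h b)) = (enum_val i == h b).
  by rewrite -(inj_eq enum_val_inj) enum_rankK.
exists (enum_rank (h true)), (enum_rank (h false)); split.
- by rewrite (inj_eq enum_rank_inj).
- by rewrite /= /ord_edge !enum_rankK.
- move=> x y; rewrite !xpair_eqE !hE /= /ord_edge.
  by case: (enum_val x) (enum_val y) => [[[[]|?]|?]|?] [[[[]|?]|?]|?] //=; rewrite
      /edge /= ?orbF ?andbF ?orbF.
Qed.

Definition or_reopt (a0 : A) : reopt_data :=
  @ReoptData #|vertex| (ograph false) (#|core| + (#|N| + #|R|))
    (Some (enum_rank @: cover_of (old_choice a0))) (ograph true) (#|core| + #|N|).

Lemma or_reopt_instance a0 : 0 < #|N| -> ePlus_CVC_instance (or_reopt a0).
Proof.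
move=> N0; split=> /=; first exact: hub_edge_addition.
  split; last first.
    by rewrite card_imset ?card_cover_of ?leq_add2l ?card_old_choice //; apply:
        enum_rank_inj.
  by apply/cvc_ograph/cover_of_cvc => c; apply: old_choice_hit.
by rewrite leq_add2l leq_addr.
Qed.

End Graph.

(** * Instance codes as templates in the input words *)

Section Template.
Variables t n : nat.
Local Notation words := {ffun 'I_t -> n.-tuple bool}.

(** This replaces a reduction algorithm: a templated code can be written on a tableau's input tape
    with at most two clauses per cell. *)
Definition templated (f : words -> seq bool) : Prop :=
  exists s : seq (token t n), forall Y, f Y = [seq fill Y k | k <- s].

Lemma templated_cat f g : templated f -> templated g -> templated (fun Y => f Y ++
    g Y).
Proof. by move=> [s fs] [s' gs]; exists (s ++ s') => Y; rewrite fs gs map_cat. Qed.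

Lemma templated_const u : templated (fun=> u).
Proof.
exists [seq (None, b) | b <- u] => Y; rewrite -map_comp.
by elim: u => //= b u <-.
Qed.

Lemma templated_map (I : Type) (g : words -> I -> bool) (e : seq I) :
  (forall i, token_valued (g^~ i)) -> templated (fun Y => [seq g Y i | i <- e]).
Proof.
move=> gt; elim: e => [|i e [s IH]]; first by exists [::].
by have [k ik] := gt i; exists (k :: s) => Y /=; rewrite ik IH.
Qed.

Lemma templated_allpairs (I : Type) (g : words -> I -> I -> bool) (e e' : seq I) :
  (forall i j, token_valued (fun Y => g Y i j)) ->
  templated (fun Y => [seq g Y i j | i <- e, j <- e']).
Proof.
move=> gt; elim: e => [|i e IH]; first by exists [::].
by apply: templated_cat => //; apply: templated_map.
Qed.

Lemma enc_or_reopt (N A R : finType) (lit : words -> R -> N -> A -> bool) (a0 : A) :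
  (forall r m a, token_valued (fun Y => lit Y r m a)) ->
  templated (fun Y => enc_reopt (or_reopt (lit Y) a0)).
Proof.
move=> lt.
(* Only adjacencies between a clause row and a value set depend on [Y], and each is a single
   literal, since one of the two arcs is always absent. *)
have edge_tok hub x y : token_valued (fun Y => edge (lit Y) hub x y).
  have E : forall x y, (forall Y, arc (lit Y) hub y x = false) ->
     token_valued (fun Y => arc (lit Y) hub x y) -> token_valued (fun Y => edge
         (lit Y) hub x y).
    by move=> x' y' nyx [k kP]; exists k => Y; rewrite /edge nyx orbF.
  have E' : forall x y, token_valued (fun Y => edge (lit Y) hub x y) ->
      token_valued (fun Y => edge (lit Y) hub y x).
    by move=> x' y' [k kP]; exists k => Y; rewrite edge_sym.
  have K (g : words -> bool) b : (forall Y, g Y = b) -> token_valued g.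
    by move=> gb; exists (None, b) => Y; rewrite gb.
  case: x y => [[[b|[m|r]]|c]|s] [[[b'|[m'|r']]|c']|s']; try exact: token_const.
  - exact: (K _ (hub && (b != b') || hub && (b' != b))).
  - exact: (K _ _ (fun Y => edge_leaf (lit Y) hub _ _)).
  - exact: (K _ _ (fun Y => edge_leaf (lit Y) hub _ _)).
  - by apply: E => //; case: s' => [[m' a']|r']; apply: token_const.
  - exact: (K _ _ (fun Y => edge_leaf (lit Y) hub _ _)).
  - by apply: E => //; case: s' => [[m' a']|r']; [apply: lt | apply: token_const].
  - by apply/E'/E => //; case: s => [[m a]|r]; [apply: lt | apply: token_const].
have graph_tok hub : templated (fun Y => enc_graph (ograph (lit Y) hub)).
  by apply: templated_cat; [exact: templated_const | apply: templated_allpairs => i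
      j; apply: edge_tok].
rewrite /enc_reopt /enc_CVC /or_reopt; cbn [ri_order ri_old ri_k ri_sol ri_new
    ri_k'].
apply: templated_cat.
  by apply: templated_cat; [exact: graph_tok | exact: templated_const].
apply: templated_cat; first exact: templated_const.
by apply: templated_cat; [exact: graph_tok | exact: templated_const].
Qed.

End Template.

Lemma size_enc_graph n (G : sgraph 'I_n) : size (enc_graph G) = n.+1 + n * n.
Proof.
by rewrite size_cat size_rcons size_nseq size_allpairs size_enum_ord.
Qed.

Lemma size_enc_sol n (s : option {set 'I_n}) : size (enc_sol s) <= n.+1.
Proof. by case: s => [B|] //=; rewrite (size_map _ (enum 'I_n)) size_enum_ord. Qed.

Lemma size_enc_CVC n (G : sgraph 'I_n) k : size (enc_CVC G k) = n.+1 + n * n + k.+1.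
Proof. by rewrite (size_cat (enc_graph G)) size_enc_graph size_rcons size_nseq. Qed.

Lemma size_enc_reopt (I : reopt_data) (n := ri_order I) :
  size (enc_reopt I) <=
  (n.+1 + n * n + (ri_k I).+1) + (n.+1 + (n.+1 + n * n + (ri_k' I).+1)).
Proof.
rewrite (size_cat (enc_CVC _ _)) (size_cat (enc_sol _)) !size_enc_CVC.
by rewrite leq_add2l leq_add2r size_enc_sol.
Qed.

Definition vertex_bound (k t : nat) := 4 + 5 * k + k * (k * t).

Lemma or_instances (L : language) : in_NP L ->
  exists2 kappa, pbounded kappa & forall n t,
  exists (I : {ffun 'I_t.+1 -> n.-tuple bool} -> reopt_data) (s : seq (token t.+1
      n)),
  [/\ forall Y, ePlus_CVC_instance (I Y),
      forall Y, ri_k (I Y) <= kappa n,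
      forall Y, CVC (ri_new (I Y)) (ri_k' (I Y)) <-> exists i, L (Y i),
      forall Y, enc_reopt (I Y) = [seq fill Y k | k <- s]
    & size s <= 10 * ((vertex_bound (kappa n) t.+1).+1 * (vertex_bound (kappa n)
        t.+1).+1)].
Proof.
move=> /np_gadget[kappa pk H].
(* The old parameter is [2 + 2 * (#|N| + #|R|)]. *)
exists (fun n => 2 + 4 * kappa n); first by pb.
move=> n t; have [N [A [R [lit [[N0 A0 leN leR leA] tok litP]]]]] := H n t.
have [a0 _] := card_gt0P A0.
have [s sP] := enc_or_reopt a0 tok.
exists (fun Y => or_reopt (lit Y) a0), s; split=> // [Y|Y|Y|].
- exact: or_reopt_instance.
- by move: leN leR; rewrite /= card_core; move: #|N| #|R| => x y; lia.
- by rewrite /= CVC_ograph CVC_vgraph.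
have := sP [ffun=> nseq_tuple n false]; move/(congr1 size); rewrite size_map => <-.
apply: leq_trans (size_enc_reopt _) _.
have : #|vertex N A R| <= vertex_bound (2 + 4 * kappa n) t.+1.
  rewrite card_vertex card_core /vertex_bound.
  have : #|N| * #|A| <= (2 + 4 * kappa n) * ((2 + 4 * kappa n) * t.+1).
    apply: leq_mul; first by apply: leq_trans leN _; lia.
    by apply: leq_trans leA _; rewrite leq_mul2r; lia.
  move: leN leR; move: #|N| #|A| #|R| => x a y; move: (x * a) (_ * (_ * _)) => p b;
      lia.
rewrite /= card_core.
have : 2 + (#|N| + #|R|) + (#|N| + #|R|) <= vertex_bound (2 + 4 * kappa n) t.+1.
  rewrite /vertex_bound; move: leN leR; move: #|N| #|R| (_ * (_ * _)) => x y z; lia.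
move: #|N| #|R| #|vertex N A R| (vertex_bound _ _) => x y v b.
nia.
Qed.

(** * Distillation *)

(* Fortnow and Santhanam: since [#|P| < 2 ^ t], the most popular value of [F] on
   [t]-tuples over [S] is taken on tuples that together use more than half of [S].
       *)
Lemma popular_values (X P : finType) (t n : nat) (F : {ffun 'I_t -> X} -> P)
    (S0 S : {set X}) :
  #|P| < 2 ^ t -> S \subset S0 -> #|S| < 2 ^ n ->
  exists2 V : {set P}, #|V| <= n
    & (forall p, p \in V -> exists2 Y : {ffun 'I_t -> X}, (forall i, Y i \in S0) &
        F Y = p) /\
      (forall x, x \in S -> exists2 Y : {ffun 'I_t -> X}, F Y \in V & exists i, Y i
          = x).
Proof.
move=> ltP; elim: n S => [|n IH] S sub ltS.
  exists set0; first by rewrite cards0.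
  split=> [p|x xS]; first by rewrite inE.
  by move: ltS; rewrite (cardsD1 x) xS.
have [-> | [x0 x0S]] := set_0Vmem S.
  by exists set0; rewrite ?cards0 //; split=> x; rewrite inE.
pose pre p := [set Y in ffun_on (mem S) | F Y == p].
pose p := [arg max_(p > F [ffun=> x0]) #|pre p|].
have maxp p' : #|pre p'| <= #|pre p|.
  by rewrite /p; case: arg_maxnP => // p1 _; apply.
have le_pre : #|S| ^ t <= #|P| * #|pre p|.
  have -> : #|S| ^ t = #|ffun_on (mem S) : pred {ffun 'I_t -> X}|.
    by rewrite card_ffun_on card_ord.
  rewrite -[X in X <= _]sum1_card (partition_big F predT) //=.
  apply: (@leq_trans (\sum_(p' : P) #|pre p|)); last first.
    by rewrite sum_nat_const leq_mul ?max_card.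
  apply: leq_sum => p' _; apply: leq_trans (maxp p').
  by rewrite sum1_card; apply/eq_leq/eq_card => Y; rewrite !inE.
pose U := [set x in S | [exists Y in pre p, [exists i, Y i == x]]].
have le_U : #|pre p| <= #|U| ^ t.
  have -> : #|U| ^ t = #|ffun_on (mem U) : pred {ffun 'I_t -> X}|.
    by rewrite card_ffun_on card_ord.
  apply/subset_leq_card/subsetP => Y Yp; apply/ffun_onP => i.
  rewrite inE; apply/andP; split.
    by move: Yp; rewrite inE => /andP[/ffun_onP/(_ i)].
  by apply/exists_inP; exists Y => //; apply/existsP; exists i.
have St : 0 < #|S| ^ t by rewrite expn_gt0 (cardsD1 x0) x0S.
(* Otherwise [(2 * #|U|) ^ t <= #|S| ^ t <= #|P| * #|U| ^ t], against [#|P| < 2 ^ t]. *)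
have ltU : #|S| < 2 * #|U|.
  rewrite ltnNge; apply/negP => le2.
  have : (2 * #|U|) ^ t <= #|S| ^ t by case: (t) => // t'; rewrite leq_exp2r.
  rewrite expnMn; have := leq_trans le_pre (leq_mul (leqnn #|P|) le_U).
  move: ltP St; move: (2 ^ t) (#|S| ^ t) (#|U| ^ t) #|P| => a b c d; nia.
have US : U \subset S by apply/subsetP => x; rewrite inE => /andP[].
(* Less than half of [S] remains. [S0] stays fixed, so later tuples are still over the original
   set. *)
have [|| V leV [V1 V2]] := IH (S :\: U).
- exact: subset_trans (subsetDl _ _) sub.
- rewrite cardsD (setIidPr US); move: ltS; rewrite expnS.
  move: #|S| #|U| ltU => s u; lia.
exists (p |: V); first by rewrite cardsU1 -add1n leq_add // leq_b1.
split=> [p' /setU1P[-> | /V1 //] | x xS].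
  have [pre0 | [Y]] := set_0Vmem (pre p).
    by move: (leq_trans St le_pre); rewrite pre0 cards0 muln0.
  rewrite inE => /andP[/ffun_onP YS /eqP]; exists Y => // i.
  exact: (subsetP sub).
case: (boolP (x \in U)) => [|nU].
  rewrite inE => /andP[_ /exists_inP[Y Yp /existsP[i /eqP Yi]]].
  exists Y; last by exists i.
  by move: Yp; rewrite !inE => /andP[_ ->].
have [Y YV Yi] := V2 x (ltac:(by rewrite inE nU)).
by exists Y; rewrite // inE YV orbT.
Qed.

(** The non-bit that ends an output of length at most [m] lies at position at most [m], so [m + 1]
    cells determine the output. *)
Lemma leading_bits_local (S : finType) m (r r' : seq (cell S)) :
  size (leading_bits r) <= m -> (forall j, j <= m -> nth None r j = nth None r' j)
      ->
  leading_bits r' = leading_bits r.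
Proof.
elim: m r r' => [|m IH] [|c r] [|c' r'] //= sz E.
- by have := E 0 isT => /= <-.
- by have := E 0 isT => /= ->.
- have /= <- := E 0 isT; by case: c sz E => [[]|].
- by have := E 0 isT => /= <-.
- by have := E 0 isT => /= ->.
have /= Ec := E 0 isT; rewrite -Ec.
case: c sz E {Ec} => [[b|?]|] //= sz E; congr cons.
by apply: IH => // j jm; apply: (E j.+1).
Qed.

Lemma enc_nat_inj a b u v : enc_nat a ++ u = enc_nat b ++ v -> a = b /\ u = v.
Proof.
elim: a b => [|a IH] [|b] //=; first by case.
by case=> /IH[-> ->].
Qed.

Lemma enc_CVC_inj n n' (G : sgraph 'I_n) (G' : sgraph 'I_n') k k' :
  enc_CVC G k = enc_CVC G' k' -> CVC G k <-> CVC G' k'.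
Proof.
rewrite /enc_CVC /enc_graph -!catA => /enc_nat_inj[En]; subst n'.
move/eqP; rewrite eqseq_cat; last by rewrite !size_allpairs.
move=> /andP[/eqP Eadj /eqP].
rewrite -[enc_nat k]cats0 -[enc_nat k']cats0 => /enc_nat_inj[-> _].
have EG x y : G x y = G' x y.
  have /eq_in_allpairs_dep H := Eadj.
  by apply: H; rewrite ?mem_enum.
have ER (B : {set 'I_n}) : [rel u v in B | G u v] =2 [rel u v in B | G' u v].
  by move=> u v /=; rewrite EG.
split=> -[B [[cov con] leB]]; exists B; do 2 split=> //.
- by move=> x y; rewrite -EG; apply: cov.
- by move=> x y xB yB; rewrite -(eq_connect (ER B)); apply: con.
- by move=> x y; rewrite EG; apply: cov.
- by move=> x y xB yB; rewrite (eq_connect (ER B)); apply: con.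
Qed.

(** * Runs of the kernelization as advice *)

(** The distilled value is this prefix and not the output word: it lives in a finite type and is
    read cell by cell off a tableau. *)
Definition tape_prefix (M : TM) m (c : config M) : {ffun 'I_m.+1 -> cell (tm_sym
    M)} :=
  [ffun j => nth None (c.2 ord0).2 (nat_of_ord j)].

Lemma output_prefix (M : TM) m (c c' : config M) :
  size (output c) <= m -> tape_prefix m c = tape_prefix m c' -> output c' = output
      c.
Proof.
move=> sz /ffunP E; apply: (leading_bits_local sz) => j jm.
by have := E (Ordinal (jm : j < m.+1)); rewrite !ffunE.
Qed.

Section Run.
Variables (M : TM) (n t T B m : nat) (toks : seq (token t.+1 n)).
Variable V : {set {ffun 'I_m.+1 -> cell (tm_sym M)}}.
Hypothesis toksB : size toks + T + m + 3 <= B.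

Let X : finType := option ('I_n + 'I_t.+1 * 'I_n).
(** Membership in [V] is built into the values, so it costs no clause. *)
Let E : finType := ('I_t.+1 * {p | p \in V} * bool)%type.
Let node := tab_node M T B X.
Let alt := tab_alt M E.

Implicit Type s : node -> alt.

Let xbit s (j : 'I_n) := (s (inl (Some (inl j)))).2.2.
Let ybit s (p : 'I_t.+1 * 'I_n) := (s (inl (Some (inr p)))).2.2.

Definition run_words s : {ffun 'I_t.+1 -> n.-tuple bool} :=
  [ffun i => [tuple ybit s (i, j) | j < n]].

Definition run_input s : seq bool := [seq fill (run_words s) k | k <- toks].

Definition run_rows : nat :=
  tableau_rows M T B + ((tm_work M).+1 * ((B.*2).+1 * 2)
  + (t.+1 * (n * 2) + m.+1 * #|{: cell (tm_sym M)}|)).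

Definition run_ok s : Prop :=
  [/\ tableau s, starts_with (run_input s) s,
      forall i, (s (inl None)).2.1.1 == i -> forall j, ybit s (i, j) = xbit s j
    & forall j : 'I_m.+1, cell_at s T ord0 (B + j) = val (s (inl None)).2.1.2 j].

Lemma expr_run : expressible run_rows run_ok.
Proof.
have E2 : expressible ((tm_work M).+1 * ((B.*2).+1 * 2))
    (fun s => starts_with (run_input s) s).
  apply: expr_starts_with => // p pB.
  have E1 c : expressible 1 (fun s => cell_at s 0 ord0 (B + p) = c).
    exact: (@expr_eq _ _ _ _ (fun a : alt => a.1.1)).
  case: (ltnP p (size toks)) => [pt | tp]; last first.
    apply: (@expr_le _ _ 1) => //; apply: expr_ext (E1 None) => s.
    suff -> : nth None [seq Some (inl b) | b <- run_input s] p = None :> cell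
        (tm_sym M) by [].
    by rewrite nth_default // (size_map _ (run_input s)) (size_map _ toks).
  pose k := nth (None, false) toks p.
  apply: (@expr_ext _ _ _ (fun s => cell_at s 0 ord0 (B + p) = Some (inl (fill
      (run_words s) k)))).
    move=> s; rewrite /run_input (nth_map false); last by rewrite (size_map _ toks).
    by rewrite (nth_map (None, false)).
  rewrite /fill; case: k => -[[i j]|] b /=; last first.
    by apply: (@expr_le _ _ 1) => //; apply: E1.
  rewrite -card_bool -[#|_|]muln1.
  apply: (@expr_ext _ _ _ (fun s => cell_at s 0 ord0 (B + p) = Some (inl (ybit s
      (i, j) (+) b)))).
    by move=> s; rewrite /run_words ffunE tnth_mktuple.
  exact: (@expr_read _ _ _ _ _ (fun a : alt => a.2.2)
      (fun y s => cell_at s 0 ord0 (B + p) = Some (inl (y (+) b)))).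
have E3 : expressible (t.+1 * (n * 2)) (fun s =>
    forall i, (s (inl None)).2.1.1 == i -> forall j, ybit s (i, j) = xbit s j).
  apply: expr_forall_ord => i.
  apply: (@expr_imply _ _ _ _ (fun a : alt => a.2.1.1 == i)).
  apply: expr_forall_ord => j; rewrite -card_bool -[#|_|]muln1.
  apply: (@expr_read _ _ _ _ _ (fun a : alt => a.2.2) (fun x s => ybit s (i, j) =
      x)) => x.
  exact: (@expr_eq _ _ _ _ (fun a : alt => a.2.2)).
have E4 : expressible (m.+1 * #|{: cell (tm_sym M)}|) (fun s =>
    forall j : 'I_m.+1, cell_at s T ord0 (B + j) = val (s (inl None)).2.1.2 j).
  apply: expr_forall_ord => j; rewrite -[#|_|]muln1.
  apply: (@expr_read _ _ _ _ _ (fun a : alt => a.1.1)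
    (fun c s => c = val (s (inl None)).2.1.2 j)) => c.
  apply: (expr_ext _ (@expr_eq _ _ _ (inl None) (fun a : alt => val a.2.1.2 j) c))
      => s.
  by split=> ->.
apply: expr_ext (expr_and (@expr_tableau M T B X E) (expr_and E2 (expr_and E3 E4)))
    => s.
by split=> [[? [? []]] | []].
Qed.

Lemma run_okP (x : n.-tuple bool) :
  (exists s, run_ok s /\ forall j, xbit s j = tnth x j) <->
  (exists2 Y : {ffun 'I_t.+1 -> n.-tuple bool},
     tape_prefix m (run M [seq fill Y k | k <- toks] T) \in V & exists i, Y i = x).
Proof.
split=> [[s [[ts us ys ps] xs]] | [Y YV [i Yi]]].
  exists (run_words s).
    have sB : size (run_input s) + T + 2 <= B by rewrite (size_map _ toks); lia.
    have [_ cells] := tableau_sound sB ts us (leqnn T).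
    suff -> : tape_prefix m (run M [seq fill (run_words s) k | k <- toks] T)
       = val (s (inl None)).2.1.2 by apply: valP.
    apply/ffunP => j; rewrite -ps ffunE.
    have jB : B + j < (B.*2).+1 by have := ltn_ord j; lia.
    rewrite (cells ord0 (Ordinal jB)) /get /= ltnNge leq_addr /=.
    by rewrite addKn.
  exists (s (inl None)).2.1.1; apply/eq_from_tnth => j.
  by rewrite /run_words ffunE tnth_mktuple ys.
pose e0 : E := (i, exist (fun p => p \in V) _ YV, false).
pose xi (y : X) : alt := (None, tm_start M,
  match y with
  | None => e0
  | Some (inl j) => (e0.1, tnth x j)
  | Some (inr p) => (e0.1, tnth (Y p.1) p.2)
  end).
pose s : node -> alt := canonical [seq fill Y k | k <- toks] xi e0.
have sY : run_words s = Y.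
  by apply/ffunP => i'; apply/eq_from_tnth => j; rewrite ffunE tnth_mktuple.
have sB : size [seq fill Y k | k <- toks] + T + 2 <= B by rewrite (size_map _
    toks); lia.
have [ts us] := canonical_tableau xi e0 sB.
exists s; split=> //; split=> //.
- by rewrite /run_input sY.
- by move=> i' /eqP <- j; rewrite /ybit /xbit /= Yi.
- move=> j; rewrite canonical_cell //; last by have := ltn_ord j; lia.
  by rewrite /= ffunE /get ltnNge leq_addr /= addKn.
Qed.

End Run.

Lemma kernel_advice (L : language) :
  in_NP L -> has_polynomial_kernel ri_k -> with_poly_advice in_coNP L.
Proof.
move=> /or_instances[kappa pk inst] [M [c ker]].
pose Sg := #|{: cell (tm_sym M)}|.
pose m n := poly_bound c (kappa n).
(* Chosen so that the [Sg ^ (m n).+1 <= 2 ^ t n] prefixes are fewer than [2 ^ (t n).+1], as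
   [popular_values] requires for [(t n).+1] words. *)
pose t n := Sg * (m n).+1.
pose sz n := 10 * ((vertex_bound (kappa n) (t n).+1).+1 * (vertex_bound (kappa n)
    (t n).+1).+1).
pose T n := poly_bound c (sz n).
pose B n := sz n + T n + m n + 3.
pose kN n := (n + (t n).+1 * n).+1 + (T n).+1 * ((tm_work M).+1 * ((B n).*2).+1).+1.
pose kA n := Sg * #|tm_state M| * ((t n).+1 * n.+1 * 2).
pose kR n := run_rows M n (t n) (T n) (B n) (m n).
apply: (@advice_of_mcnf L (fun n => kN n + kA n + kR n)).
  rewrite /kN /kA /kR /run_rows /tableau_rows /B /T /sz /vertex_bound /t /m; pb.
move=> n; have [I [toks [Iok Ik Isat Ienc sz_toks]]] := inst n (t n).
pose F (Y : {ffun 'I_(t n).+1 -> n.-tuple bool}) :=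
  tape_prefix (m n) (run M [seq fill Y k | k <- toks] (T n)).
have /fin_all_exists[noL noLP] : forall x : n.-tuple bool, exists b : bool, b <-> ~
    L x.
  by move=> x; case: (classic (L x)) => Lx; [exists false | exists true]; split.
pose S := [set x | noL x].
have [|||V leV [V1 V2]] := @popular_values _ _ _ n.+1 F S S.
- rewrite card_ffun card_ord.
  apply: (@leq_ltn_trans ((2 ^ Sg) ^ (m n).+1)).
    by rewrite leq_exp2r //; apply/ltnW/ltn_expl.
  by rewrite -expnM ltn_exp2l.
- exact: subxx.
- by apply: (leq_ltn_trans (max_card _)); rewrite card_tuple card_bool ltn_exp2l.
have FE Y : exists nJ (J : sgraph 'I_nJ) l,
    [/\ output (run M [seq fill Y k | k <- toks] (T n)) = enc_CVC J l,
        CVC J l <-> exists i, L (Y i) & size (enc_CVC J l) <= m n].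
  have [nJ [J [l [comp eqv le_sz _]]]] := ker (I Y) (Iok Y).
  exists nJ, J, l; split; last 2 first.
  - exact: iff_trans eqv (Isat Y).
  - exact: leq_trans le_sz (leq_poly_bound _ (Ik Y)).
  rewrite Ienc in comp.
  have [//|_ ->] := run_within comp (_ : _ <= T n); last by [].
  by apply: leq_poly_bound; rewrite (size_map _ toks).
have toksB : size toks + T n + m n + 3 <= B n by rewrite !leq_add2r.
have [phi le_phi phiP] := @expr_run M n (t n) (T n) (B n) (m n) toks V.
pose X : finType := option ('I_n + 'I_(t n).+1 * 'I_n).
pose E : finType := ('I_(t n).+1 * {p | p \in V} * bool)%type.
exists (tab_node M (T n) (B n) X), (tab_alt M E), phi,
  (fun j => inl (Some (inl j))), (fun a => a.2.2).
split.
- by apply/card_gt0P; exists (inl None).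
- rewrite card_sum card_prod !card_option card_sum !card_prod !card_ord.
  by rewrite /kN; lia.
- rewrite !card_prod card_ord card_bool card_sig.
  apply: (@leq_trans (kA n)); last by lia.
  by rewrite /kA leq_mul // leq_mul // leq_mul.
- by apply: leq_trans le_phi _; rewrite -/(kR n); lia.
move=> x; apply: (@iff_trans _ (exists2 Y : {ffun 'I_(t n).+1 -> n.-tuple bool},
    F Y \in V & exists i, Y i = x)).
  rewrite -(@run_okP M n (t n) (T n) (B n) (m n) toks V toksB x).
  by split=> -[s [/phiP sP sx]]; exists s; split=> //; apply/phiP.
(* A prefix in [V] also arises from a tuple [Y'] of words outside [L]. Equal prefixes give equal
   kernels, hence equal answers, so no word of [Y] is in [L], in particular not [x]. Conversely, the
   popular values reach every word outside [L]. *)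
split=> [[Y /V1[Y' Y'S FY] [i Yi]] | Lx]; last first.
  by apply: V2; rewrite inE; apply/noLP.
have [nJ [J [l [oJ JP szJ]]]] := FE Y.
have [nJ' [J' [l' [oJ' JP' szJ']]]] := FE Y'.
have oE : enc_CVC J l = enc_CVC J' l'.
  by rewrite -oJ -oJ'; apply: output_prefix FY; rewrite oJ'.
have := enc_CVC_inj oE; rewrite JP JP' => -[LYY' _] Lx.
have [|i' Li'] := LYY'; first by exists i; rewrite Yi.
by have := Y'S i'; rewrite inE => /noLP.
Qed.

Lemma kernel_param : has_polynomial_kernel ri_k' -> has_polynomial_kernel ri_k.
Proof.
move=> [M [c ker]]; exists M, c => I Iok; have [_ _ le_k] := Iok.
have [n [J [l [comp eqv le_sz le_l]]]] := ker I Iok.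
exists n, J, l; split=> //.
- exact: leq_trans le_sz (leq_poly_bound _ le_k).
- exact: leq_trans le_l (leq_poly_bound _ le_k).
Qed.

Theorem theorem13 :
  ~ NP_subset_coNP_poly ->
  ~ has_polynomial_kernel ri_k /\ ~ has_polynomial_kernel ri_k'.
Proof.
move=> noNP; split=> ker; apply: noNP => L LNP.
- exact: kernel_advice LNP ker.
- exact: kernel_advice LNP (kernel_param ker).
Qed.
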